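(* Let $\alpha=(\alpha_1,\dots,\alpha_l)\vDash_e n$ be a maximal composition with $l\ge1$. (1) If $\alpha_1$ is even then the map $\Sigma_{(\alpha_1)}\times\Sigma_{(\alpha_2,\dots,\alpha_l)}\to\Sigma_\alpha$, $(\sigma_1,\sigma_2)\mapsto\sigma_1\odot\sigma_2$, is a bijection. (2) If $\alpha_1$ is odd then the map $\Sigma^\times_{(\alpha_1)}\times\bigl(\Sigma^\times_{(\alpha_2,\dots,\alpha_l)}\bigr)^{w_0}\to\Sigma^\times_\alpha$, $(\sigma_1,\sigma_2)\mapsto\sigma_1\odot\sigma_2$, where $w_0$ is the longest element of $\mathfrak S_{\alpha_2+\dots+\alpha_l}$, is a bijection.
   Context: $[a]=\{1,\dots,a\}$. $\mathfrak S_n$ is the symmetric group on $[n]$ (products are compositions of functions), with Coxeter generators $s_i=(i,i+1)$ and Coxeter length function $\ell$ (number of inversions). $\mathfrak S_0$ is the trivial group consisting of the empty function. The longest element $w_0$ of $\mathfrak S_n$ is $w_0(i)=n-i+1$. For $X\subseteq\mathfrak S_n$, $X^{w_0}=\{w_0\sigma w_0^{-1}\mid\sigma\in X\}$. Relation $\approx$: write $w\overset{s_i}{\to}w'$ if $w'=s_iws_i$ and $\ell(w')\le\ell(w)$. Let $\to$ be the reflexive and transitive closure of the union of the relations $\overset{s_i}{\to}$, $1\le i\le n-1$. Write $w\approx w'$ if $w\to w'$ and $w'\to w$; this is an equivalence relation on $\mathfrak S_n$. A composition $\alpha=(\alpha_1,\dots,\alpha_l)$ of $n$ (finite sequence of positive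 integers with sum $n$) is maximal, written $\alpha\vDash_e n$, if there is $0\le k\le l$ such that $\alpha_i$ is even for $i\le k$, $\alpha_i$ is odd for $i>k$, and $\alpha_{k+1}\ge\dots\ge\alpha_l$. Element in stair form: let $(x_1,\dots,x_n)$ be the list with $x_{2i-1}=i$ and $x_{2i}=n-i+1$. For a composition $\alpha=(\alpha_1,\dots,\alpha_l)$ of $n$, $\sigma_\alpha\in\mathfrak S_n$ is the product of the disjoint cycles $(x_{\alpha_1+\dots+\alpha_{i-1}+1},\dots,x_{\alpha_1+\dots+\alpha_{i-1}+\alpha_i})$, $i=1,\dots,l$. For $\alpha\vDash_e n$, $\Sigma_\alpha\subseteq\mathfrak S_n$ is the $\approx$-equivalence class of $\sigma_\alpha$. For the empty composition, $\Sigma_\emptyset=\mathfrak S_0$. For $\sigma\in\mathfrak S_n$, $P(\sigma)$ is the set partition of $[n]$ into the orbits of $\sigma$. For $\alpha\vDash_e n$ put $\Sigma_\alpha^\times=\{\sigma\in\Sigma_\alpha\mid P(\sigma)=P(\sigma_\alpha)\}$. Inductive product: let $n_1,n_2\ge0$ with $n_1+n_2=n$ and $k=\lceil n_1/2\rceil$. For $\sigma_1\in\mathfrak S_{n_1}$, $\sigma_2\in\mathfrak S_{n_2}$, $\sigma_1\odot\sigma_2\in\mathfrak S_n$ is the permutation whose cycles (including trivial ones) are the cycles of $\sigma_1$ with $n_2$ added to each entry $>k$, together with the cycles of $\sigma_2$ with $k$ added to each entry. In the claim, $\odot$ is taken with $n_1=\alpha_1$ and $n_2=\alpha_2+\dots+\alpha_l$.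 *)

(* Defs.v *)
From mathcomp Require Import all_boot all_fingroup.

Set Implicit Arguments.
Unset Strict Implicit.
Unset Printing Implicit Defensive.

(* Permutations of {1, ..., n} are represented by 'S_n, the permutations of     *)
(* {0, ..., n-1}: the entry a stands for the ordinal of value a - 1.            *)
(* MathComp multiplies permutations from left to right, (s * t) x = t (s x).    *)

Definition bij_onto (aT rT : finType) (f : aT -> rT) (A : {set aT})
    (B : {set rT}) : Prop :=
  {in A &, injective f} /\ f @: A = B.

Section Coxeter.
Variable n : nat.
Implicit Types w : 'S_n.

Definition coxlen w : nat :=
  #|[set p : 'I_n * 'I_n | (p.1 < p.2) && (w p.2 < w p.1)]|.

(* The Coxeter generators are the tperm i j with j = i + 1.                     *)
Definition cox_step : rel 'S_n := fun w w' =>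
  [exists i : 'I_n, exists j : 'I_n,
    [&& j == i.+1 :> nat, w' == (tperm i j * w * tperm i j)%g
      & coxlen w' <= coxlen w]].

Definition cox_arrow : rel 'S_n := connect cox_step.

Definition cox_approx : rel 'S_n :=
  fun w w' => cox_arrow w w' && cox_arrow w' w.

Definition longest : 'S_n := perm (@rev_ord_inj n).

End Coxeter.

Definition is_composition (n : nat) (alpha : seq nat) : Prop :=
  all (leq 1) alpha /\ sumn alpha = n.

Definition maximal_composition (n : nat) (alpha : seq nat) : Prop :=
  is_composition n alpha /\
  exists k : nat,
    [/\ k <= size alpha,
        all (fun a => ~~ odd a) (take k alpha),
        all odd (drop k alpha)
      & sorted geq (drop k alpha)].

Section StairForm.
Variable n : nat.

Lemma half_ord_subproof (p : 'I_n) : p./2 < n.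
Proof.
apply: leq_ltn_trans (ltn_ord p).
by rewrite -{2}(odd_double_half p) -addnn addnA leq_addl.
Qed.

Definition half_ord (p : 'I_n) : 'I_n := Ordinal (half_ord_subproof p).

(* With 0-based positions and entries, x_(2i-1) = i and x_(2i) = n - i + 1      *)
(* read: position p holds p./2 if p is even and n - 1 - p./2 if p is odd.       *)
Definition stair_entry (p : 'I_n) : 'I_n :=
  if odd p then rev_ord (half_ord p) else half_ord p.

Definition stair_list : seq 'I_n := [seq stair_entry p | p <- enum 'I_n].

(* The cycle (c_1, ..., c_r) for pairwise distinct c_i; undup only serves to    *)
(* make the definition total.                                                   *)
Definition cycle_perm (c : seq 'I_n) : 'S_n :=
  perm (can_inj (prev_next (undup_uniq c))).

(* Meaningful for compositions alpha of n only; in that case                    *)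
(* reshape alpha cuts stair_list into blocks of sizes alpha_1, ..., alpha_l.    *)
Definition stair_perm (alpha : seq nat) : 'S_n :=
  (\prod_(c <- reshape alpha stair_list) cycle_perm c)%g.

Definition Sigma (alpha : seq nat) : {set 'S_n} :=
  [set w | cox_approx (stair_perm alpha) w].

Definition Sigma_times (alpha : seq nat) : {set 'S_n} :=
  [set w in Sigma alpha | porbits w == porbits (stair_perm alpha)].

End StairForm.

(* For an injective e : T -> T', the permutation of T' whose nontrivial cycles  *)
(* are those of s with every entry x replaced by e x.                           *)
Section Relabel.
Variables (T T' : finType) (e : T -> T').
Hypothesis e_inj : injective e.

Definition relabel_fun (s : {perm T}) (y : T') : T' :=
  if [pick x | e x == y] is Some x then e (s x) else y.

Lemma relabel_fun_img (s : {perm T}) (x : T) : relabel_fun s (e x) = e (s x).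
Proof.
rewrite /relabel_fun; case: pickP => [z /eqP/e_inj -> //|/(_ x)].
by rewrite eqxx.
Qed.

Lemma relabel_fun_out (s : {perm T}) (y : T') :
  (forall x, e x != y) -> relabel_fun s y = y.
Proof.
by rewrite /relabel_fun => ney; case: pickP => // x; rewrite (negPf (ney x)).
Qed.

Lemma relabel_funK (s : {perm T}) :
  cancel (relabel_fun s) (relabel_fun s^-1%g).
Proof.
move=> y; rewrite {2}/relabel_fun; case: pickP => [x /eqP <-|ney].
  by rewrite relabel_fun_img permK.
by apply: relabel_fun_out => x; rewrite ney.
Qed.

Definition relabel_perm (s : {perm T}) : {perm T'} :=
  perm (can_inj (relabel_funK s)).

Lemma relabel_perm_img (s : {perm T}) (x : T) : relabel_perm s (e x) = e (s x).
Proof. by rewrite permE relabel_fun_img. Qed.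

Lemma relabel_perm_out (s : {perm T}) (y : T') :
  (forall x, e x != y) -> relabel_perm s y = y.
Proof. by move=> ney; rewrite permE relabel_fun_out. Qed.

End Relabel.

Section InductiveProduct.
Variables n1 n2 : nat.

(* k = uphalf n1 is the ceiling of n1 / 2.  A 1-based entry exceeds k iff the   *)
(* corresponding 0-based entry is at least k.                                   *)
Lemma outer_subproof (i : 'I_n1) :
  (if i < uphalf n1 then i : nat else i + n2) < n1 + n2.
Proof.
by case: ifP => _; [exact: ltn_addr | rewrite ltn_add2r].
Qed.

Definition outer_label (i : 'I_n1) : 'I_(n1 + n2) := Ordinal (outer_subproof i).

Lemma inner_subproof (j : 'I_n2) : uphalf n1 + j < n1 + n2.
Proof.
rewrite -addnS leq_add // uphalf_half -{3}(odd_double_half n1) -addnn leq_add2l.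
exact: leq_addr.
Qed.

Definition inner_label (j : 'I_n2) : 'I_(n1 + n2) := Ordinal (inner_subproof j).

Lemma outer_label_inj : injective outer_label.
Proof.
move=> i j [] E; apply: val_inj => /=; move: E.
case: (ltnP i) => ik; case: (ltnP j) => jk //; last exact: addIn.
  by move=> E; move: ik; rewrite E ltnNge (leq_trans jk) ?leq_addr.
by move=> E; move: jk; rewrite -E ltnNge (leq_trans ik) ?leq_addr.
Qed.

Lemma inner_label_inj : injective inner_label.
Proof. by move=> i j [] /addnI E; apply: val_inj. Qed.

Lemma outer_neq_inner (i : 'I_n1) (j : 'I_n2) : outer_label i != inner_label j.
Proof.
apply/eqP => /(congr1 val) /=; case: (ltnP i) => ik E.
  by move: ik; rewrite E ltnNge leq_addr.
have : uphalf n1 + j < i + n2 by rewrite -addnS leq_add.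
by rewrite E ltnn.
Qed.

(* The two factors have disjoint supports, so they commute.                     *)
Definition odot (s1 : 'S_n1) (s2 : 'S_n2) : 'S_(n1 + n2) :=
  (relabel_perm outer_label_inj s1 * relabel_perm inner_label_inj s2)%g.

Lemma odot_outer (s1 : 'S_n1) (s2 : 'S_n2) (i : 'I_n1) :
  odot s1 s2 (outer_label i) = outer_label (s1 i).
Proof.
rewrite permM relabel_perm_img relabel_perm_out // => j.
by rewrite eq_sym outer_neq_inner.
Qed.

Lemma odot_inner (s1 : 'S_n1) (s2 : 'S_n2) (j : 'I_n2) :
  odot s1 s2 (inner_label j) = inner_label (s2 j).
Proof.
rewrite permM (relabel_perm_out outer_label_inj) ?relabel_perm_img // => i.
exact: outer_neq_inner.
Qed.

End InductiveProduct.

(* Main.v *)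
(* Conjugation by a Coxeter generator preserves the length (and moves the       *)
(* permutation) only if i is a descent of exactly one of w and w^-1.  If a is   *)
(* even, every element of Sigma_(a) exchanges the two halves of its entries, so *)
(* a length preserving step on s (.) t never mixes outer and inner entries, and *)
(* these steps are exactly the steps of s and of t.                             *)
(*   If all parts are odd, Sigma_alpha is the set of all permutations of        *)
(* maximal length in their conjugacy class.  Indeed every permutation climbs,   *)
(* by conjugation steps that never decrease the length, to some sigma_gamma     *)
(* (push w(x_p) towards x_(p+1), one value at a time), and the length of        *)
(* sigma_gamma is strictly largest when gamma is decreasing.  Now               *)
(* l(s (.) t) = l(s) + l(t) + n2 c(s) with c(s) the number of entries that s    *)
(* moves to the other half.  All three terms are bounded by their values for    *)
(* sigma_(a) and sigma_beta, and c(s) reaches its bound a - 1 for every a-cycle *)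
(* s of maximal length: s w_0 then has at most (a-1)/2 inversions, hence        *)
(* crosses at most (a-1)/2 of the cuts between k and k + 1, while transitivity  *)
(* of s forces it to cross one of any two opposite cuts, so one of the two      *)
(* middle cuts is not crossed.                                                  *)

Require Import Defs.
From mathcomp Require Import all_boot all_fingroup.
From mathcomp Require Import zify.

Set Implicit Arguments.
Unset Strict Implicit.
Unset Printing Implicit Defensive.

Local Open Scope nat_scope.
Local Open Scope group_scope.

(** * Length and conjugation by Coxeter generators *)

(** Both cases start from [stair_perm_cons]: the stair form of [a :: beta] is the inductive product
    of the stair cycle of length a with the stair form of [beta], conjugated by w_0 when a is odd
    because the stair list then enters the inner interval from its upper end. Injectivity is
    [odot_inj]; the content is the description of the image.

    For even a, [cox_approxE] turns the equivalence into chains of [flat_step], and [flat_step_odot]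
    shows that such a step on a product takes place in one factor, so the class of the product is
    the product of the classes.

    For odd a all parts are odd and weakly decreasing, and the class is recognised by length.
    [ascend_to_stair] climbs from any permutation to a stair form and [stair_len_sorted] compares
    the stair forms of one cycle type; together they give [max_length_in_Sigma]. Once the orbits are
    prescribed, [coxlen_odot], [crossings_le] and [crossings_max] show that a product has maximal
    length exactly when both factors do. *)

Section Length.
Variable n : nat.
Implicit Types (w s : 'S_n) (i j p q : 'I_n).

Lemma val_tperm i j p :
  tperm i j p = (if p == i :> nat then j else if p == j :> nat then i else p) :> nat.
Proof.
case: tpermP => [->|->|/eqP + /eqP]; rewrite ?eqxx //.
  by case: eqP.
by rewrite -!val_eqE => /negPf -> /negPf ->.
Qed.

Lemma tperm_adj_lt i j p q : j = i.+1 :> nat ->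
  ~~ ((p == i :> nat) && (q == j :> nat)) ->
  ~~ ((p == j :> nat) && (q == i :> nat)) ->
  (tperm i j p < tperm i j q) = (p < q).
Proof.
move=> ij; rewrite !val_tperm.
by do ?case: ifP; lia.
Qed.

Definition inversions w := [set p : 'I_n * 'I_n | (p.1 < p.2) && (w p.2 < w p.1)].

(** Exchanging two adjacent positions carries the old inversions along bijectively and creates the
    single new one (i, j). *)
Lemma coxlen_tpermL i j w : j = i.+1 :> nat -> w i < w j ->
  coxlen (tperm i j * w) = (coxlen w).+1.
Proof.
move=> ij wij; rewrite /coxlen -/(inversions _) -/(inversions w).
pose f (p : 'I_n * 'I_n) := (tperm i j p.1, tperm i j p.2).
have finv : involutive f by case=> p q; rewrite /f /= !tpermK.
have fmem x (A : {set _}) : (x \in f @: A) = (f x \in A).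
  by rewrite -{1}(finv x) mem_imset //; exact: inv_inj.
have -> : inversions (tperm i j * w) = (i, j) |: f @: inversions w.
  apply/setP=> -[p q]; rewrite in_setU1 fmem !inE /f /= !permM xpair_eqE -!val_eqE /=.
  case: (boolP ((p == i :> nat) && (q == j :> nat))) =>
    [/andP[/eqP/ord_inj-> /eqP/ord_inj->]|npq].
    by rewrite tpermL tpermR wij; lia.
  case: (boolP ((p == j :> nat) && (q == i :> nat))) =>
    [/andP[/eqP/ord_inj-> /eqP/ord_inj->]|npq'].
    by rewrite tpermL tpermR; lia.
  by rewrite tperm_adj_lt.
rewrite cardsU1 card_imset; last exact: inv_inj.
rewrite fmem inE /f /= tpermL tpermR.
by have -> : (j < i) = false by lia.
Qed.

Lemma coxlenV w : coxlen w^-1 = coxlen w.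
Proof.
pose f (p : 'I_n * 'I_n) := (w p.2, w p.1).
have finj : injective f by case=> p q [p' q'] [/perm_inj-> /perm_inj->].
rewrite /coxlen -[RHS](card_imset _ finj); apply: eq_card => -[p q].
have -> : (p, q) = f (w^-1 q, w^-1 p) by rewrite /f /= !permKV.
by rewrite mem_imset // !inE /f /= !permKV andbC.
Qed.

Lemma coxlen_tpermL_des i j w : j = i.+1 :> nat -> w j < w i ->
  coxlen w = (coxlen (tperm i j * w)).+1.
Proof.
by move=> ij wij; rewrite -{1}(tpermKg i j w) coxlen_tpermL // !permM tpermL tpermR.
Qed.

Lemma coxlen_tpermR i j w : coxlen (w * tperm i j) = coxlen (tperm i j * w^-1).
Proof. by rewrite -coxlenV invMg tpermV. Qed.

Lemma coxlen_tpermR_asc i j w : j = i.+1 :> nat -> w^-1 i < w^-1 j ->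
  coxlen (w * tperm i j) = (coxlen w).+1.
Proof. by move=> ij wij; rewrite coxlen_tpermR coxlen_tpermL // coxlenV. Qed.

Lemma coxlen_tpermR_des i j w : j = i.+1 :> nat -> w^-1 j < w^-1 i ->
  coxlen w = (coxlen (w * tperm i j)).+1.
Proof. by move=> ij wij; rewrite coxlen_tpermR -coxlen_tpermL_des // coxlenV. Qed.

Lemma adj_asc_or_des i j w : j = i.+1 :> nat -> {w i < w j} + {w j < w i}.
Proof.
move=> ij; case: (ltngtP (w i) (w j)); auto.
by move=> /ord_inj/perm_inj E; move: ij; rewrite E; lia.
Qed.

Lemma coxlen_conj_asc i j w : j = i.+1 :> nat -> w i < w j ->
  coxlen w <= coxlen (tperm i j * w * tperm i j).
Proof.
move=> ij wij; have E := coxlen_tpermL ij wij.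
have [a|d] := adj_asc_or_des (tperm i j * w)^-1 ij.
  by rewrite (coxlen_tpermR_asc ij a) E; lia.
by rewrite -ltnS -(coxlen_tpermR_des ij d) E.
Qed.

Lemma coxlen_conjV i j w :
  coxlen (tperm i j * w^-1 * tperm i j) = coxlen (tperm i j * w * tperm i j).
Proof. by rewrite -coxlenV !invMg invgK tpermV mulgA. Qed.

Lemma coxlen_conj_ascV i j w : j = i.+1 :> nat -> w^-1 i < w^-1 j ->
  coxlen w <= coxlen (tperm i j * w * tperm i j).
Proof. by move=> ij wij; rewrite -coxlen_conjV -coxlenV coxlen_conj_asc. Qed.

(** If w is moved, its inverse does not map {i, j} to itself, so multiplying on one side leaves the
    descent read on the other side unchanged. The two length changes cancel exactly when one is up
    and the other down. *)
Lemma coxlen_conj_eq i j w : j = i.+1 :> nat ->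
  tperm i j * w * tperm i j != w ->
  (coxlen (tperm i j * w * tperm i j) == coxlen w)
    = ((w j < w i) (+) (w^-1 j < w^-1 i)).
Proof.
move=> ij nfix.
have wi : w (w^-1 i) = i by rewrite permKV.
have wj : w (w^-1 j) = j by rewrite permKV.
have nij : ~~ ((w^-1 i == i :> nat) && (w^-1 j == j :> nat)).
  apply: contra nfix => /andP[/eqP/ord_inj Ei /eqP/ord_inj Ej].
  by move: wi wj; rewrite Ei Ej (conjgC _ w) tpermJ => -> ->; rewrite -mulgA tperm2 mulg1.
have nji : ~~ ((w^-1 i == j :> nat) && (w^-1 j == i :> nat)).
  apply: contra nfix => /andP[/eqP/ord_inj Ei /eqP/ord_inj Ej].
  by move: wi wj; rewrite Ei Ej (conjgC _ w) tpermJ tpermC => -> ->;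
    rewrite -mulgA tperm2 mulg1.
have tV p : (tperm i j * w)^-1 p = tperm i j (w^-1 p).
  by rewrite invMg permM tpermV.
have tlt : (tperm i j (w^-1 i) < tperm i j (w^-1 j)) = (w^-1 i < w^-1 j).
  by rewrite tperm_adj_lt.
have tgt : (tperm i j (w^-1 j) < tperm i j (w^-1 i)) = (w^-1 j < w^-1 i).
  by rewrite tperm_adj_lt // andbC.
have [a|d] := adj_asc_or_des w ij; have [a'|d'] := adj_asc_or_des w^-1 ij.
- have E : coxlen (tperm i j * w * tperm i j) = (coxlen w).+2.
    by rewrite (coxlen_tpermR_asc ij) ?tV ?tlt // (coxlen_tpermL ij a).
  by rewrite E; lia.
- have E : (coxlen (tperm i j * w * tperm i j)).+1 = (coxlen w).+1.
    by rewrite -(coxlen_tpermR_des ij) ?tV ?tgt // (coxlen_tpermL ij a).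
  by case: E => ->; lia.
- have E : coxlen (tperm i j * w * tperm i j) = coxlen w.
    by rewrite (coxlen_tpermR_asc ij) ?tV ?tlt // -(coxlen_tpermL_des ij d).
  by rewrite E; lia.
- have E : (coxlen (tperm i j * w * tperm i j)).+2 = coxlen w.
    by rewrite -(coxlen_tpermR_des ij) ?tV ?tgt // -(coxlen_tpermL_des ij d).
  by rewrite -E; lia.
Qed.

End Length.

(** * Length-preserving steps and the symmetry under w_0 *)

Section Steps.
Variable n : nat.
Implicit Types (w s : 'S_n) (i j p q : 'I_n).

(** Phrased by descents instead of lengths, so that a step can be tested inside one factor of an
    inductive product. *)
Definition flat_step : rel 'S_n := fun w w' =>
  [exists i : 'I_n, exists j : 'I_n,
    [&& j == i.+1 :> nat, w' == tperm i j * w * tperm i j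
      & (w j < w i) (+) (w^-1 j < w^-1 i)]].

Lemma cox_stepP w w' :
  reflect (exists i j, [/\ j = i.+1 :> nat, w' = tperm i j * w * tperm i j
                         & coxlen w' <= coxlen w]) (cox_step w w').
Proof.
apply: (iffP existsP) => [[i /existsP[j /and3P[/eqP ij /eqP Ew l]]]|[i [j [ij Ew l]]]].
  by exists i, j.
by exists i; apply/existsP; exists j; rewrite -Ew l ij !eqxx.
Qed.

Lemma flat_stepP w w' :
  reflect (exists i j, [/\ j = i.+1 :> nat, w' = tperm i j * w * tperm i j
                         & (w j < w i) (+) (w^-1 j < w^-1 i)]) (flat_step w w').
Proof.
apply: (iffP existsP) => [[i /existsP[j /and3P[/eqP ij /eqP Ew l]]]|[i [j [ij Ew l]]]].
  by exists i, j.
by exists i; apply/existsP; exists j; rewrite Ew l ij !eqxx.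
Qed.

Lemma conj_tperm w i j : tperm i j * w * tperm i j = w ^ tperm i j.
Proof. by rewrite conjgE tpermV mulgA. Qed.

Lemma conj_tpermK w i j :
  tperm i j * (tperm i j * w * tperm i j) * tperm i j = w.
Proof. by rewrite !conj_tperm -conjgM tperm2 conjg1. Qed.

Lemma flat_step_len w w' : flat_step w w' -> coxlen w' = coxlen w.
Proof.
case/flat_stepP=> i [j [ij -> d]].
have [-> //|nf] := eqVneq (tperm i j * w * tperm i j) w.
by apply/eqP; rewrite coxlen_conj_eq.
Qed.

Lemma flat_step_cox w w' : flat_step w w' -> cox_step w w' && cox_step w' w.
Proof.
move=> st; have E := flat_step_len st.
case/flat_stepP: st E => i [j [ij -> _]] E.
apply/andP; split; apply/cox_stepP; exists i, j; split=> //.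
- by rewrite E.
- by rewrite conj_tpermK.
- by rewrite E.
Qed.

Lemma cox_step_flat w w' :
  cox_step w w' -> coxlen w' = coxlen w -> (w' == w) || flat_step w w'.
Proof.
case/cox_stepP=> i [j [ij -> _]] /eqP E.
have [//|nf] := eqVneq (tperm i j * w * tperm i j) w.
by apply/flat_stepP; exists i, j; rewrite -coxlen_conj_eq.
Qed.

Lemma cox_arrow_len w w' : cox_arrow w w' -> coxlen w' <= coxlen w.
Proof.
case/connectP=> p; elim: p w => [|v p IHp] w /=; first by move=> _ ->.
by case/andP=> /cox_stepP[i [j [_ _ l]]] pp /(IHp _ pp)/leq_trans; apply.
Qed.

(** Lengths never rise along the path, so under this hypothesis each step preserves the length and
    is flat or trivial. *)
Lemma cox_arrow_flat w w' :
  cox_arrow w w' -> coxlen w <= coxlen w' -> connect flat_step w w'.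
Proof.
case/connectP=> p; elim: p w => [|v p IHp] w /=; first by move=> _ ->.
case/andP=> st pp Ew' l.
have vw : cox_arrow v w' by apply/connectP; exists p.
have lv : coxlen v <= coxlen w by case/cox_stepP: st => ? [? []].
have lw' := cox_arrow_len vw.
have Ev : coxlen v = coxlen w by apply/eqP; rewrite eqn_leq lv (leq_trans l).
have c := IHp _ pp Ew' (leq_trans lv l).
by case/orP: (cox_step_flat st Ev) => [/eqP<- // | /connect1 /connect_trans]; apply.
Qed.

Lemma cox_approxE : @cox_approx n =2 connect flat_step.
Proof.
move=> w w'; apply/andP/idP => [[a b]|c]; first exact: cox_arrow_flat (cox_arrow_len b).
case/connectP: c => p; elim: p w => [|v p IHp] w /=.
  by move=> _ ->; split; exact: connect0.
case/andP=> /flat_step_cox/andP[a b] pp /(IHp _ pp)[a' b'].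
by split; [exact: connect_trans (connect1 a) a' | exact: connect_trans b' (connect1 b)].
Qed.

Lemma cox_approx_len w w' : cox_approx w w' -> coxlen w' = coxlen w.
Proof.
by case/andP=> /cox_arrow_len a /cox_arrow_len b; apply/eqP; rewrite eqn_leq a.
Qed.

Lemma cox_arrow_approx w w' :
  cox_arrow w w' -> coxlen w <= coxlen w' -> cox_approx w w'.
Proof. by rewrite cox_approxE; exact: cox_arrow_flat. Qed.

Lemma cox_arrow_conj w w' : cox_arrow w w' -> exists g, w' = w ^ g.
Proof.
case/connectP=> p; elim: p w => [|v p IHp] w /=.
  by move=> _ ->; exists 1; rewrite conjg1.
case/andP=> /cox_stepP[i [j [_ Ev _]]] pp /(IHp _ pp)[g ->].
by exists (tperm i j * g); rewrite conjgM -conj_tperm Ev.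
Qed.

Lemma longestV : (longest n)^-1 = longest n.
Proof.
apply/permP => p; apply: (@perm_inj _ (longest n)).
by rewrite permKV !permE rev_ordK.
Qed.

Lemma longestK : cancel (fun w => w ^ longest n) (fun w => w ^ longest n).
Proof. by move=> w; rewrite -conjgM -{1}longestV mulVg conjg1. Qed.

Lemma longestJ w p : (w ^ longest n) p = rev_ord (w (rev_ord p)).
Proof. by rewrite conjgE longestV !permM !permE. Qed.

Lemma rev_ord_lt p q : (rev_ord p < rev_ord q) = (q < p).
Proof. by rewrite /=; have := ltn_ord p; have := ltn_ord q; lia. Qed.

Lemma coxlen_longestJ w : coxlen (w ^ longest n) = coxlen w.
Proof.
pose f (p : 'I_n * 'I_n) := (rev_ord p.2, rev_ord p.1).
have finv : involutive f by case=> p q; rewrite /f !rev_ordK.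
have finj := inv_inj finv.
rewrite /coxlen -[RHS](card_imset _ finj); apply: eq_card => -[p q].
by rewrite -[in RHS](finv (p, q)) mem_imset // !inE /f !longestJ !rev_ord_lt.
Qed.

(** Conjugation by w_0 permutes the Coxeter generators and, reversing both positions and values,
    keeps lengths. *)
Lemma cox_arrow_longestJ w w' :
  cox_arrow w w' -> cox_arrow (w ^ longest n) (w' ^ longest n).
Proof.
case/connectP=> p; elim: p w => [|v p IHp] w /=; first by move=> _ ->; exact: connect0.
case/andP=> /cox_stepP[i [j [ij Ev l]]] pp /(IHp _ pp); apply: connect_trans.
apply/connect1/cox_stepP; exists (rev_ord j), (rev_ord i); split.
- by rewrite /= ij; have := ltn_ord j; lia.
- rewrite Ev !conj_tperm -!conjgM; congr (_ ^ _).
  by rewrite conjgC tpermJ !permE tpermC.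
- by rewrite !coxlen_longestJ.
Qed.

End Steps.

(** * Cycle type and inductive products *)

Lemma porbit_morph (T T' : finType) (s : {perm T}) (t : {perm T'}) (e : T -> T') x :
  (forall y, t (e y) = e (s y)) -> porbit t (e x) = e @: porbit s x.
Proof.
move=> te.
have tX k y : (t ^+ k) (e y) = e ((s ^+ k) y).
  by elim: k y => [|k IHk] y; rewrite ?expg0 ?perm1 // !expgS !permM te IHk.
apply/setP=> z; apply/porbitP/imsetP => [[k ->]|[y /porbitP[k ->] ->]].
  by exists ((s ^+ k) x); rewrite ?mem_porbit.
by exists k.
Qed.

Section CycleType.
Variable T : finType.
Implicit Types (s t : {perm T}) (P Q : {set {set T}}).

(** Listed in the order of [enum], so it is compared up to [perm_eq] only. *)
Definition block_sizes P : seq nat := [seq #|X| | X : {set T} <- enum P].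

Definition cycle_type s := block_sizes (porbits s).

Lemma block_sizesU P Q : [disjoint P & Q] ->
  perm_eq (block_sizes (P :|: Q)) (block_sizes P ++ block_sizes Q).
Proof.
move=> dPQ; rewrite -map_cat; apply: perm_map.
apply: uniq_perm; rewrite ?cat_uniq ?enum_uniq ?andbT //=.
  apply/hasPn => X; rewrite !mem_enum => XQ.
  by rewrite (disjointFl dPQ).
by move=> X; rewrite mem_cat !mem_enum inE.
Qed.

Lemma porbitsJ s t : porbits (s ^ t) = [set t @: (X : {set T}) | X in porbits s].
Proof.
have E x : porbit (s ^ t) (t x) = t @: porbit s x.
  by apply: porbit_morph => y; rewrite permJ.
apply/setP=> X; apply/imsetP/imsetP => [[x _ ->]|[_ /imsetP[x _ ->] ->]].
  by exists (porbit s (t^-1 x)); rewrite ?imset_f // -E permKV.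
by exists (t x); rewrite ?E.
Qed.

End CycleType.

Lemma block_sizes_imset (T T' : finType) (e : T -> T') (P : {set {set T}}) :
  injective e ->
  perm_eq (block_sizes [set e @: (X : {set T}) | X in P]) (block_sizes P).
Proof.
move=> e_inj; have im_inj := imset_inj e_inj.
have -> : block_sizes P =
    [seq #|X| | X : {set T'} <- [seq e @: (X : {set T}) | X <- enum P]].
  by rewrite -map_comp; apply: eq_map => X /=; rewrite card_imset.
apply: perm_map; apply: uniq_perm; rewrite ?enum_uniq ?map_inj_uniq //.
  by rewrite enum_uniq.
move=> X; rewrite mem_enum; apply/imsetP/mapP => -[Y YP ->]; exists Y => //.
  by rewrite mem_enum.
by rewrite mem_enum in YP.
Qed.

Lemma cycle_typeJ (T : finType) (s t : {perm T}) :
  perm_eq (cycle_type (s ^ t)) (cycle_type s).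
Proof. rewrite /cycle_type porbitsJ; apply: block_sizes_imset; exact: perm_inj. Qed.

(** * Order, cycles and length of an inductive product *)

Section Odot.
Variables n1 n2 : nat.
Implicit Types (i : 'I_n1) (j : 'I_n2) (s : 'S_n1) (t : 'S_n2).
Local Notation out := (@outer_label n1 n2).
Local Notation inn := (@inner_label n1 n2).

Lemma outer_lt i i' : (out i < out i') = (i < i').
Proof. by rewrite /=; case: (ltnP i (uphalf n1)); case: (ltnP i' (uphalf n1)); lia. Qed.

Lemma inner_lt j j' : (inn j < inn j') = (j < j').
Proof. by rewrite /= ltn_add2l. Qed.

(** The inner labels sit between the two halves of the outer ones, so the half of [i] alone
    decides. *)
Lemma outer_inner_lt i j : (out i < inn j) = (i < uphalf n1).
Proof. by rewrite /=; case: (ltnP i (uphalf n1)); have := ltn_ord j; lia. Qed.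

Lemma inner_outer_lt i j : (inn j < out i) = ~~ (i < uphalf n1).
Proof. by rewrite /=; case: (ltnP i (uphalf n1)); have := ltn_ord j; lia. Qed.

Variant label_spec : 'I_(n1 + n2) -> Prop :=
  | OuterLabel i : label_spec (out i)
  | InnerLabel j : label_spec (inn j).

Definition label_of (x : 'I_n1 + 'I_n2) : 'I_(n1 + n2) :=
  match x with inl i => out i | inr j => inn j end.

Lemma label_of_bij : bijective label_of.
Proof.
apply: inj_card_bij; last by rewrite card_sum !card_ord.
move=> [i|j] [i'|j'] /=.
- by move/outer_label_inj->.
- by move=> E; have := outer_neq_inner i j'; rewrite E eqxx.
- by move=> E; have := outer_neq_inner i' j; rewrite E eqxx.
- by move/inner_label_inj->.
Qed.

Lemma labelP x : label_spec x.
Proof.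
case: label_of_bij => g _ gK; rewrite -(gK x).
by case: (g x) => [i|j]; constructor.
Qed.

Lemma sum_labels (F : 'I_(n1 + n2) -> nat) :
  \sum_x F x = \sum_i F (out i) + \sum_j F (inn j).
Proof. by rewrite (reindex label_of) ?big_sumType //; exact/onW_bij/label_of_bij. Qed.

Lemma perm_odot_ext (w : 'S_(n1 + n2)) s t :
  (forall i, w (out i) = out (s i)) -> (forall j, w (inn j) = inn (t j)) ->
  w = odot s t.
Proof.
by move=> wo wi; apply/permP => x; case: (labelP x) => ?; rewrite ?odot_outer ?odot_inner.
Qed.

Lemma odot_inj s s' t t' : odot s t = odot s' t' -> s = s' /\ t = t'.
Proof.
move=> E; split; apply/permP => x.
  by apply: (@outer_label_inj n1 n2); rewrite -(odot_outer s t) E odot_outer.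
by apply: (@inner_label_inj n1 n2); rewrite -(odot_inner s t) E odot_inner.
Qed.

Lemma odotM s s' t t' : odot (s * s') (t * t') = odot s t * odot s' t'.
Proof. by apply/esym/perm_odot_ext => x; rewrite 2!permM !(odot_outer, odot_inner). Qed.

Lemma odot1 : @odot n1 n2 1 1 = 1.
Proof. by apply/esym/perm_odot_ext => x; rewrite !perm1. Qed.

Lemma odotV s t : odot s^-1 t^-1 = (odot s t)^-1.
Proof. by apply: (mulgI (odot s t)); rewrite -odotM !mulgV odot1. Qed.

Lemma tperm_outer i i' : tperm (out i) (out i') = odot (tperm i i') 1.
Proof.
apply: perm_odot_ext => x; last by rewrite perm1 tpermD ?outer_neq_inner.
by rewrite -inj_tperm //; exact: outer_label_inj.
Qed.

Lemma tperm_inner j j' : tperm (inn j) (inn j') = odot 1 (tperm j j').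
Proof.
apply: perm_odot_ext => x; first by rewrite perm1 tpermD // eq_sym outer_neq_inner.
by rewrite -inj_tperm //; exact: inner_label_inj.
Qed.

Lemma porbit_outer s t i : porbit (odot s t) (out i) = out @: porbit s i.
Proof. by apply: porbit_morph => x; rewrite odot_outer. Qed.

Lemma porbit_inner s t j : porbit (odot s t) (inn j) = inn @: porbit t j.
Proof. by apply: porbit_morph => x; rewrite odot_inner. Qed.

Lemma porbits_odot s t :
  porbits (odot s t) = [set out @: (X : {set 'I_n1}) | X in porbits s]
                   :|: [set inn @: (X : {set 'I_n2}) | X in porbits t].
Proof.
apply/setP=> X; rewrite inE; apply/imsetP/orP => [[x _ ->]|].
  case: (labelP x) => [i|j]; [left|right].
    by rewrite porbit_outer !imset_f.
  by rewrite porbit_inner !imset_f.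
case=> /imsetP[_ /imsetP[x _ ->] ->].
  by exists (out x); rewrite ?porbit_outer.
by exists (inn x); rewrite ?porbit_inner.
Qed.

Lemma cycle_type_odot s t :
  perm_eq (cycle_type (odot s t)) (cycle_type s ++ cycle_type t).
Proof.
rewrite /cycle_type porbits_odot.
apply: perm_trans (block_sizesU _) (perm_cat _ _); last 2 first.
- by apply: block_sizes_imset; exact: outer_label_inj.
- by apply: block_sizes_imset; exact: inner_label_inj.
rewrite disjoint_subset; apply/subsetP => _ /imsetP[_ /imsetP[x _ ->] ->].
rewrite inE; apply/negP => /imsetP[_ /imsetP[y _ ->] E].
have : out x \in inn @: porbit t y by rewrite -E imset_f // porbit_id.
by case/imsetP => z _ Ez; have := outer_neq_inner x z; rewrite Ez eqxx.
Qed.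

(** For odd [n1] the middle entry belongs to the lower half. *)
Definition crossings s := #|[set i : 'I_n1 | (i < uphalf n1) (+) (s i < uphalf n1)]|.

Lemma coxlen_sum n (w : 'S_n) :
  coxlen w = \sum_(p < n) \sum_(q < n) ((p < q) && (w q < w p) : nat).
Proof.
rewrite pair_bigA /= /coxlen -sum1_card [RHS]big_mkcond [LHS]big_mkcond /=.
by apply: eq_bigr => p _; rewrite inE; case: ifP.
Qed.

(** Inversions split into outer, inner and mixed pairs. A mixed pair is inverted exactly when its
    outer entry changes halves, whatever the inner entry is, so each crossing contributes [n2]. *)
Lemma coxlen_odot s t :
  coxlen (odot s t) = coxlen s + coxlen t + (n2 * crossings s)%N.
Proof.
rewrite !coxlen_sum sum_labels.
under eq_bigr => i _ do rewrite sum_labels.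
under [X in _ + X]eq_bigr => j _ do rewrite sum_labels.
rewrite !big_split /=.
have -> : \sum_(i < n1) \sum_(i' < n1)
    ((out i < out i') && (odot s t (out i') < odot s t (out i)) : nat)
  = \sum_(p < n1) \sum_(q < n1) ((p < q) && (s q < s p) : nat).
  by do 2 apply: eq_bigr => ? _; rewrite !odot_outer !outer_lt.
have -> : \sum_(j < n2) \sum_(j' < n2)
    ((inn j < inn j') && (odot s t (inn j') < odot s t (inn j)) : nat)
  = \sum_(p < n2) \sum_(q < n2) ((p < q) && (t q < t p) : nat).
  by do 2 apply: eq_bigr => ? _; rewrite !odot_inner !inner_lt.
have -> : \sum_(i < n1) \sum_(j < n2)
    ((out i < inn j) && (odot s t (inn j) < odot s t (out i)) : nat)
  = \sum_(i < n1) (n2 * ((i < uphalf n1) && ~~ (s i < uphalf n1)))%N.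
  apply: eq_bigr => i _; under eq_bigr => j _ do
    rewrite odot_inner odot_outer outer_inner_lt inner_outer_lt.
  by rewrite sum_nat_const card_ord.
have -> : \sum_(j < n2) \sum_(i < n1)
    ((inn j < out i) && (odot s t (out i) < odot s t (inn j)) : nat)
  = \sum_(i < n1) (n2 * (~~ (i < uphalf n1) && (s i < uphalf n1)))%N.
  rewrite exchange_big; apply: eq_bigr => i _; under eq_bigr => j _ do
    rewrite odot_inner odot_outer outer_inner_lt inner_outer_lt.
  by rewrite sum_nat_const card_ord.
have -> : (n2 * crossings s)%N =
  \sum_(i < n1) (n2 * ((i < uphalf n1) && ~~ (s i < uphalf n1)))%N +
  \sum_(i < n1) (n2 * (~~ (i < uphalf n1) && (s i < uphalf n1)))%N.
  rewrite -big_split /= /crossings -sum1_card big_distrr big_mkcond /=.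
  by apply: eq_bigr => i _; rewrite inE; case: (i < _); case: (s i < _);
    rewrite ?muln0 ?muln1 ?addn0.
by rewrite [RHS]addnACA [in RHS](addnC (\sum_(p < n2) _)).
Qed.

End Odot.

(** * Stair forms *)

Section Stair.
Variable n : nat.

Lemma val_stair_entry (p : 'I_n) :
  stair_entry p = (if odd p then n - p./2.+1 else p./2) :> nat.
Proof. by rewrite /stair_entry; case: ifP. Qed.

Lemma stair_entry_inj : injective (@stair_entry n).
Proof.
move=> p q /(congr1 (@nat_of_ord n)); rewrite !val_stair_entry => E.
apply: ord_inj; move: E; have := ltn_ord p; have := ltn_ord q.
by case: ifP; case: ifP; lia.
Qed.

Lemma stair_list_uniq : uniq (stair_list n).
Proof. by rewrite map_inj_uniq ?enum_uniq //; exact: stair_entry_inj. Qed.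

Lemma cycle_permE (c : seq 'I_n) x : cycle_perm c x = next (undup c) x.
Proof. by rewrite permE. Qed.

Lemma next_enum_ord (p q : 'I_n) :
  q = (if p.+1 == n then 0 else p.+1) :> nat -> next (enum 'I_n) p = q.
Proof.
move=> Eq; rewrite next_nth mem_enum /=.
case E: (enum 'I_n) => [|y e]; first by have := mem_enum 'I_n p; rewrite E.
have sz : size (y :: e) = n by rewrite -E size_enum_ord.
have ip : index p (y :: e) = p by rewrite -E index_enum_ord.
rewrite ip; case: (eqVneq p.+1 n) Eq => [pn|pn] Eq.
  (* At the last position [next] returns its default, the head of the list, which closes the
     cycle. *)
  rewrite nth_default; last by rewrite -ltnS -/(size (y :: e)) sz pn.
  by apply: ord_inj; rewrite Eq -[y]/(nth y (y :: e) 0) -E nth_enum_ord // -pn.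
rewrite -[nth _ _ _]/(nth y (y :: e) p.+1) -E -Eq.
by apply: ord_inj; rewrite nth_enum_ord.
Qed.

Lemma stair_perm1 : stair_perm n [:: n] = cycle_perm (stair_list n).
Proof.
by rewrite /stair_perm /= big_seq1 take_oversize // size_map size_enum_ord.
Qed.

Lemma stair_perm1_entry (p q : 'I_n) :
  q = (if p.+1 == n then 0 else p.+1) :> nat ->
  stair_perm n [:: n] (stair_entry p) = stair_entry q.
Proof.
move=> /next_enum_ord E; rewrite stair_perm1 cycle_permE undup_id ?stair_list_uniq //.
by rewrite next_map ?enum_uniq ?E //; exact: stair_entry_inj.
Qed.

End Stair.

Section Relabel.
Variables (T T' : finType) (e : T -> T').
Hypothesis e_inj : injective e.

Lemma relabel_permM s t :
  relabel_perm e_inj (s * t) = relabel_perm e_inj s * relabel_perm e_inj t.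
Proof.
apply/permP=> y; rewrite permM; have [/existsP[x /eqP <-]|] := boolP [exists x, e x == y].
  by rewrite !relabel_perm_img permM.
by rewrite negb_exists => /forallP ney; rewrite !relabel_perm_out.
Qed.

Lemma relabel_perm1 : relabel_perm e_inj 1 = 1.
Proof. by apply: (mulgI (relabel_perm e_inj 1)); rewrite -relabel_permM !mulg1. Qed.

Lemma relabel_perm_comp (g : {perm T}) (eg_inj : injective (e \o g)) s :
  relabel_perm eg_inj s = relabel_perm e_inj (s ^ g).
Proof.
apply/permP=> y; have [/existsP[x /eqP <-]|] := boolP [exists x, e x == y].
  by rewrite relabel_perm_img -{1 2}(permKV g x) permJ (relabel_perm_img eg_inj).
rewrite negb_exists => /forallP ney; rewrite !relabel_perm_out // => x.
exact: ney.
Qed.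

End Relabel.

Lemma cycle_perm_map n n' (e : 'I_n -> 'I_n') (e_inj : injective e) c :
  cycle_perm (map e c) = relabel_perm e_inj (cycle_perm c).
Proof.
apply/permP=> y; rewrite cycle_permE undup_map_inj //.
have [/existsP[x /eqP <-]|] := boolP [exists x, e x == y].
  by rewrite relabel_perm_img next_map ?undup_uniq // cycle_permE.
rewrite negb_exists => /forallP ney; rewrite !relabel_perm_out //.
rewrite next_nth; case: ifP => // /mapP[x _ E].
by have := ney x; rewrite E eqxx.
Qed.

Section StairProduct.
Variables a m : nat.

(* The stair list of the remaining interval starts at its upper end when [a] is odd. *)
Definition turn : 'S_m := if odd a then longest m else 1.

Lemma stair_entry_outer (p : 'I_a) :
  stair_entry (lshift m p) = outer_label m (stair_entry p).
Proof.
apply: ord_inj; rewrite /= !val_stair_entry /=.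
have := ltn_ord p; case: (boolP (odd p)) => podd pa; case: ifP; lia.
Qed.

Lemma stair_entry_inner (p : 'I_m) :
  stair_entry (rshift a p) = inner_label a (turn (stair_entry p)).
Proof.
apply: ord_inj; rewrite /= !val_stair_entry /= /turn oddD.
have := ltn_ord p; case: (boolP (odd a)) => aodd; rewrite ?permE /= val_stair_entry.
  by case: (boolP (odd p)) => podd /=; lia.
by case: (boolP (odd p)) => podd /=; lia.
Qed.

Lemma enum_ordD :
  enum 'I_(a + m) = map (@lshift a m) (enum 'I_a) ++ map (@rshift a m) (enum 'I_m).
Proof.
apply: (inj_map (@ord_inj (a + m))).
rewrite val_enum_ord iotaD map_cat -2!map_comp; congr (_ ++ _).
  exact/esym/val_enum_ord.
by rewrite add0n -{1}(addn0 a) iotaDl -val_enum_ord -map_comp.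
Qed.

Lemma inner_turn_inj : injective (@inner_label a m \o turn).
Proof. exact: inj_comp (@inner_label_inj a m) (@perm_inj _ turn). Qed.

Lemma stair_list_cat :
  stair_list (a + m) = map (@outer_label a m) (stair_list a)
                    ++ map (@inner_label a m \o turn) (stair_list m).
Proof.
rewrite /stair_list enum_ordD map_cat -!map_comp; congr (_ ++ _); apply: eq_map => p /=.
  exact: stair_entry_outer.
exact: stair_entry_inner.
Qed.

(** The first block lists the outer labels in stair order, the others the inner labels in stair
    order up to [turn]. Relabelling is multiplicative, so the inner cycles multiply to a relabelled
    stair form and the turn becomes a conjugation. *)
Lemma stair_perm_cons beta :
  stair_perm (a + m) (a :: beta) = odot (stair_perm a [:: a]) (stair_perm m beta ^ turn).
Proof.
have sz : size (map (@outer_label a m) (stair_list a)) = a.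
  by rewrite 2!size_map size_enum_ord.
rewrite {1}/stair_perm /= big_cons stair_list_cat.
rewrite (take_size_cat _ sz) (drop_size_cat _ sz) /odot.
congr (_ * _); first by rewrite stair_perm1 (cycle_perm_map (@outer_label_inj a m)).
rewrite -(relabel_perm_comp _ inner_turn_inj) -map_reshape big_map.
rewrite (big_morph _ (relabel_permM inner_turn_inj) (relabel_perm1 _)).
by apply: eq_bigr => c _; exact: cycle_perm_map.
Qed.

End StairProduct.

(** * Even first part *)

Section FlatOdot.
Variables a m : nat.
Implicit Types (s : 'S_a) (t : 'S_m).

Lemma flat_step_inner s t t' : flat_step t t' -> flat_step (odot s t) (odot s t').
Proof.
case/flat_stepP=> i [j [ij -> d]]; apply/flat_stepP.
exists (inner_label a i), (inner_label a j); split.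
- by rewrite /= ij addnS.
- by rewrite tperm_inner -!odotM mul1g mulg1.
- by rewrite -odotV !odot_inner !inner_lt.
Qed.

Lemma cox_step_inner s t t' : cox_step t t' -> cox_step (odot s t) (odot s t').
Proof.
case/cox_stepP=> i [j [ij -> d]]; apply/cox_stepP.
exists (inner_label a i), (inner_label a j); split.
- by rewrite /= ij addnS.
- by rewrite tperm_inner -!odotM mul1g mulg1.
- by rewrite !coxlen_odot leq_add2r leq_add2l.
Qed.

Lemma cox_arrow_inner s t t' : cox_arrow t t' -> cox_arrow (odot s t) (odot s t').
Proof.
case/connectP=> p; elim: p t => [|v p IHp] t /=; first by move=> _ ->; exact: connect0.
by case/andP=> /(cox_step_inner s)/connect1 st pp /(IHp _ pp); exact: connect_trans.
Qed.

(** The invariant that keeps flat steps from mixing the factors. It can hold only for even [a], the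
    halves having then equal size. *)
Definition swaps_halves s := [forall x, (s x < uphalf a) == ~~ (x < uphalf a)].

Lemma swaps_halvesP s :
  reflect (forall x, (s x < uphalf a) = ~~ (x < uphalf a)) (swaps_halves s).
Proof. exact: 'forall_eqP. Qed.

Lemma swaps_halvesV s : swaps_halves s -> swaps_halves s^-1.
Proof.
by move/swaps_halvesP=> sw; apply/swaps_halvesP => x; rewrite -{2}(permKV s x) sw negbK.
Qed.

Lemma swaps_halves_des s (i j : 'I_a) :
  swaps_halves s -> i < uphalf a <= j -> s j < s i.
Proof.
move/swaps_halvesP=> sw /andP[ik kj].
have := sw i; have := sw j; rewrite ik ltnNge -leqNgt kj /=; lia.
Qed.

(** Across the boundary of the halves, [i] would be a descent of both [s] and its inverse, which the
    exclusive or forbids. *)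
Lemma flat_step_same_half s (i j : 'I_a) : swaps_halves s -> j = i.+1 :> nat ->
  (s j < s i) (+) (s^-1 j < s^-1 i) -> (i < uphalf a) = (j < uphalf a).
Proof.
move=> sw ij; case: (ltnP i (uphalf a)) => ik; case: (ltnP j (uphalf a)) => jk //.
  by rewrite !swaps_halves_des ?swaps_halvesV ?ik.
by move: ik jk; rewrite ij; lia.
Qed.

Lemma swaps_halves_step s s' : flat_step s s' -> swaps_halves s -> swaps_halves s'.
Proof.
case/flat_stepP=> i [j [ij -> d]] sw.
have half_t (x : 'I_a) : (tperm i j x < uphalf a) = (x < uphalf a).
  by have E := flat_step_same_half sw ij d; case: tpermP => [->|->|].
move/swaps_halvesP: (sw) => swE.
by apply/swaps_halvesP => x; rewrite 2!permM half_t swE half_t.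
Qed.

Lemma flat_step_outer s s' t :
  swaps_halves s -> flat_step s s' -> flat_step (odot s t) (odot s' t).
Proof.
move=> sw /flat_stepP[i [j [ij -> d]]]; apply/flat_stepP.
exists (outer_label m i), (outer_label m j); split.
- by rewrite /= (flat_step_same_half sw ij d); case: ifP; rewrite ij.
- by rewrite tperm_outer -!odotM mul1g mulg1.
- by rewrite -odotV !odot_outer !outer_lt.
Qed.

Lemma flat_step_odot s t w : swaps_halves s -> flat_step (odot s t) w ->
  (exists2 s', flat_step s s' & w = odot s' t) \/
  (exists2 t', flat_step t t' & w = odot s t').
Proof.
move=> sw /flat_stepP[x [y [xy -> d]]]; have swV := swaps_halvesV sw.
move: xy d; rewrite -odotV.
case: (labelP x) => i; case: (labelP y) => j xy; rewrite ?odot_outer ?odot_inner.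
- rewrite !outer_lt => d; left; exists (tperm i j * s * tperm i j).
    apply/flat_stepP; exists i, j; split=> //.
    by move: xy => /=; case: (ltnP i (uphalf a)); case: (ltnP j (uphalf a)); lia.
  by rewrite tperm_outer -!odotM mul1g mulg1.
- move: xy; rewrite !inner_outer_lt => xy.
  have ik : i < uphalf a by rewrite -(outer_inner_lt i j) xy.
  by move/swaps_halvesP: sw => ->; move/swaps_halvesP: swV => ->; rewrite ik.
- move: xy; rewrite !outer_inner_lt => xy.
  have jk : ~~ (j < uphalf a) by rewrite -(inner_outer_lt j i) xy.
  by move/swaps_halvesP: sw => ->; move/swaps_halvesP: swV => ->; rewrite jk.
- rewrite !inner_lt => d; right; exists (tperm i j * t * tperm i j).
    apply/flat_stepP; exists i, j; split=> //.
    by move: xy => /=; rewrite -addnS => /addnI.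
  by rewrite tperm_inner -!odotM mul1g mulg1.
Qed.

Lemma connect_flat_outer s s' t : swaps_halves s -> connect (@flat_step a) s s' ->
  swaps_halves s' /\ connect (@flat_step (a + m)) (odot s t) (odot s' t).
Proof.
move=> sw /connectP[p]; elim: p s sw => [|v p IHp] s sw /=.
  by move=> _ ->; split.
case/andP=> st pp /(IHp _ (swaps_halves_step st sw) pp)[sw' c]; split=> //.
by apply: connect_trans c; apply/connect1/flat_step_outer.
Qed.

Lemma connect_flat_inner s t t' : connect (@flat_step m) t t' ->
  connect (@flat_step (a + m)) (odot s t) (odot s t').
Proof.
case/connectP=> p; elim: p t => [|v p IHp] t /=; first by move=> _ ->; exact: connect0.
by case/andP=> /(flat_step_inner s)/connect1 st pp /(IHp _ pp); exact: connect_trans.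
Qed.

Lemma connect_flat_odot s t w : swaps_halves s ->
  connect (@flat_step (a + m)) (odot s t) w ->
  exists s' t', [/\ connect (@flat_step a) s s', connect (@flat_step m) t t'
                  & w = odot s' t'].
Proof.
move=> sw /connectP[p]; elim: p s t sw => [|v p IHp] s t sw /=.
  by move=> _ ->; exists s, t.
case/andP=> /(flat_step_odot sw)[[s1 st ->]|[t1 st ->]] pp.
  case/(IHp _ _ (swaps_halves_step st sw) pp) => s' [t' [cs ct ->]].
  by exists s', t'; split=> //; exact: connect_trans (connect1 st) cs.
case/(IHp _ _ sw pp) => s' [t' [cs ct ->]].
by exists s', t'; split=> //; exact: connect_trans (connect1 st) ct.
Qed.

End FlatOdot.

Lemma stair_entry_lt n (p : 'I_n) :
  (stair_entry p < uphalf n) = ~~ odd p.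
Proof. by rewrite val_stair_entry; have := ltn_ord p; case: ifP; lia. Qed.

Lemma stair_entryP n (x : 'I_n) : exists p : 'I_n, x = stair_entry p.
Proof.
have [g _ gK] : bijective (@stair_entry n) by exact: injF_bij (@stair_entry_inj n).
by exists (g x).
Qed.

Lemma next_index n (p : 'I_n) :
  exists q : 'I_n, q = (if p.+1 == n then 0 else p.+1) :> nat.
Proof.
case: eqVneq => [E|ne]; last first.
  have lt : p.+1 < n by have := ltn_ord p; lia.
  by exists (Ordinal lt).
have lt : 0 < n by have := ltn_ord p; lia.
by exists (Ordinal lt).
Qed.

(** The parity of a stair position tells the half, and parities alternate along the cycle, also
    where it closes since [a] is even. *)
Lemma stair_perm1_swaps a : ~~ odd a -> swaps_halves (stair_perm a [:: a]).
Proof.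
move=> even_a; apply/swaps_halvesP => x; case: (stair_entryP x) => p ->.
case: (next_index p) => q Eq; rewrite (stair_perm1_entry Eq) !stair_entry_lt Eq.
case: eqVneq => [E|_] //=.
by rewrite -oddS E even_a.
Qed.

Lemma SigmaE n alpha w :
  (w \in Sigma n alpha) = connect (@flat_step n) (stair_perm n alpha) w.
Proof. by rewrite inE cox_approxE. Qed.

Theorem odot_bij_even a beta : ~~ odd a ->
  bij_onto (fun s : 'S_a * 'S_(sumn beta) => odot s.1 s.2)
    (setX (Sigma a [:: a]) (Sigma (sumn beta) beta))
    (Sigma (a + sumn beta) (a :: beta)).
Proof.
move=> even_a; have sw := stair_perm1_swaps even_a.
have E : stair_perm (a + sumn beta) (a :: beta)
       = odot (stair_perm a [:: a]) (stair_perm (sumn beta) beta).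
  by rewrite stair_perm_cons /turn (negPf even_a) conjg1.
split; first by move=> [s t] [s' t'] _ _ /= /odot_inj[-> ->].
apply/setP=> w; rewrite SigmaE E; apply/imsetP/idP => [[[s t] /setXP[]]|c].
  rewrite !SigmaE => cs ct -> /=.
  have [_ cs'] := connect_flat_outer (stair_perm (sumn beta) beta) sw cs.
  exact: connect_trans cs' (connect_flat_inner s ct).
have [s [t [cs ct ->]]] := connect_flat_odot sw c.
by exists (s, t) => //; rewrite inE /= !SigmaE cs.
Qed.

(** * Cycles of odd length *)

Section Cuts.
Variable n : nat.
Implicit Types (u w : 'S_n).

(** [longest] reverses the values, so each pair of positions is inverted by exactly one of the two
    permutations. *)
Lemma coxlen_mul_longest w :
  coxlen w + coxlen (w * longest n) = \sum_(p < n) \sum_(q < n) (p < q).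
Proof.
rewrite !coxlen_sum -big_split; apply: eq_bigr => p _.
rewrite -big_split; apply: eq_bigr => q _ /=.
rewrite !permM !permE rev_ord_lt; case: (ltnP p q) => //= pq.
by case: ltngtP => //= /ord_inj/perm_inj E; move: pq; rewrite E ltnn.
Qed.

Definition cut_stable u (k : nat) := [forall p, (u p < k) == (p < k)].

Lemma cut_stableP u k :
  reflect (forall p, (u p < k) = (p < k)) (cut_stable u k).
Proof. exact: 'forall_eqP. Qed.

Lemma no_descent_id u :
  (forall i j : 'I_n, j = i.+1 :> nat -> u i < u j) -> u = 1.
Proof.
move=> asc; have ge (p : 'I_n) : p <= u p.
  case: p => p; elim: p => [|p IHp] lt //=.
  have lt' := ltnW lt.
  exact: leq_ltn_trans (IHp lt') (asc (Ordinal lt') (Ordinal lt) _).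
have le k (p : 'I_n) : n = p + k.+1 -> u p <= p.
  elim: k p => [|k IHk] p E; first by have := ltn_ord (u p); lia.
  have lt : p.+1 < n by lia.
  have := IHk (Ordinal lt); have := asc p (Ordinal lt) erefl; rewrite /=; lia.
apply/permP => p; rewrite perm1; apply: ord_inj; apply/eqP.
rewrite eqn_leq ge andbT (le (n - p.+1)) //.
by have := ltn_ord p; lia.
Qed.

(* Each cut crossed by [u] accounts for at least one letter in a reduced word of [u]. *)
Lemma unstable_cuts_le u : #|[set k : 'I_n | ~~ cut_stable u k]| <= coxlen u.
Proof.
have [c] := ubnP (coxlen u); elim: c u => // c IHc u; rewrite ltnS => uc.
have [/existsP[i /existsP[j /andP[/eqP ij d]]]|nd] :=
    boolP [exists i : 'I_n, exists j : 'I_n, (j == i.+1 :> nat) && (u j < u i)].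
  have Eu := coxlen_tpermL_des ij d; rewrite Eu in uc *.
  have := IHc _ uc; rewrite -ltnS; apply: leq_trans.
  (* Exchanging the positions i and j affects no cut other than [j], the one that separates them. *)
  have sub : [set k : 'I_n | ~~ cut_stable u k]
      \subset j |: [set k : 'I_n | ~~ cut_stable (tperm i j * u) k].
    apply/subsetP => k; rewrite !inE; case: eqVneq => //= kj; apply: contra.
    move/cut_stableP => st; apply/cut_stableP => p.
    have := st (tperm i j p); rewrite permM tpermK => ->; rewrite val_tperm.
    by move: kj; rewrite -val_eqE /=; do ?case: ifP; lia.
  by apply: leq_trans (subset_leq_card sub) _; rewrite cardsU1; case: (_ \notin _).
have -> : u = 1.
  apply: no_descent_id => i j ij; have [//|d] := adj_asc_or_des u ij.
  by case/existsP: nd; exists i; apply/existsP; exists j; rewrite ij eqxx.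
apply: leq_trans (leq0n _); rewrite leqn0 cards_eq0.
apply/eqP/setP => k; rewrite !inE; apply/negbF.
by apply/cut_stableP => p; rewrite perm1.
Qed.

End Cuts.

Lemma porbit_stable (T : finType) (w : {perm T}) (X : pred T) x :
  (forall y, X y -> X (w y)) -> porbit w x = setT -> X x -> forall y, X y.
Proof.
move=> st full Xx y; have /porbitP[k ->] : y \in porbit w x by rewrite full inE.
by elim: k => [|k IHk]; rewrite ?perm1 // expgSr permM st.
Qed.

Section OddCycle.
Variable a : nat.
Hypothesis a_odd : odd a.
Local Notation h := a./2.

Lemma porbit_setT (w : 'S_a) x : porbits w = [set setT] -> porbit w x = setT.
Proof. by move=> E; apply/set1P; rewrite -E imset_f. Qed.

(** If [u] stabilises one of the middle cuts h and h + 1, all entries but one change halves under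
    [w]. Otherwise h + 1 unstable cuts can be collected, more than the length of [u] allows. *)
Lemma crossings_ge (w : 'S_a) : porbits w = [set setT] ->
  coxlen (w * longest a) <= h -> a.-1 <= crossings w.
Proof.
move=> wT len; set u := w * longest a in len.
have uE p : u p = rev_ord (w p) by rewrite permM permE.
have Ea : a = h.*2.+1 by rewrite -{1}(odd_double_half a) a_odd.
have lth : h < a by lia.
(* Otherwise the i outermost entries on both sides would form a [w]-stable set that misses the
   middle entry. *)
have stable_pair (i : nat) : 0 < i <= h -> ~~ (cut_stable u i && cut_stable u (a - i)).
  move=> i_h; apply/negP => /andP[/cut_stableP st1 /cut_stableP st2].
  pose X (p : 'I_a) := (p < i) || (a - i <= p).
  have Xw p : X p -> X (w p).
    have := st1 p; have := st2 p; rewrite !uE /X /=.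
    have := ltn_ord (w p); have := ltn_ord p; lia.
  have X0 : X (Ordinal (leq_ltn_trans (leq0n _) lth)) by rewrite /X /=; lia.
  have := porbit_stable Xw (porbit_setT _ wT) X0 (Ordinal lth).
  by rewrite /X /=; lia.
have cross_but (c : 'I_a) : (forall p, p != c -> (p < uphalf a) (+) (w p < uphalf a)) ->
    a.-1 <= crossings w.
  move=> cr; rewrite -{1}(card_ord a) -(cardsC1 c); apply: subset_leq_card.
  by apply/subsetP => p; rewrite !inE; exact: cr.
have [/cut_stableP st|ns1] := boolP (cut_stable u h).
  apply: (cross_but (Ordinal lth)) => p; rewrite -val_eqE /=; have := st p.
  by rewrite uE /=; have := ltn_ord (w p); lia.
have [/cut_stableP st|ns2] := boolP (cut_stable u h.+1).
  apply: (cross_but (w^-1 (Ordinal lth))) => p.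
  rewrite -(inj_eq (@perm_inj _ w)) permKV -val_eqE /=; have := st p.
  by rewrite uE /=; have := ltn_ord (w p); lia.
have h_gt0 : 0 < h.
  by rewrite lt0n; apply: contra ns1 => /eqP ->; apply/cut_stableP.
have lth1 : h.+1 < a by lia.
(* One unstable cut from each opposite pair. From the middle pair it takes h, so that h + 1 can be
   counted in addition. *)
pose cut (i : 'I_h) := if cut_stable u i.+1 then a - i.+1 else i.+1.
have cut_lt i : cut i < a by rewrite /cut; have := ltn_ord i; case: ifP; lia.
pose S := [set k : 'I_a | ~~ cut_stable u k].
pose g i := Ordinal (cut_lt i).
have g_inj : injective g.
  move=> i j [E]; apply: ord_inj; move: E; rewrite /cut.
  by have := ltn_ord i; have := ltn_ord j; do 2 case: ifP; lia.
have gS : [set g i | i in 'I_h] \subset S :\ Ordinal lth1.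
  apply/subsetP => _ /imsetP[i _ ->]; rewrite !inE -val_eqE /= /cut.
  have lti := ltn_ord i; have := stable_pair i.+1.
  case: ifP => [st|ns] sp; last by rewrite ns andbT; lia.
  have -> : ~~ cut_stable u (a - i.+1) by apply: sp; lia.
  rewrite andbT; apply: contra ns1 => /eqP E.
  by have <- : i.+1 = h by lia.
have := unstable_cuts_le u; rewrite -/S (cardsD1 (Ordinal lth1)) inE ns2 add1n.
have := subset_leq_card gS; rewrite card_imset // card_ord; lia.
Qed.

(** The product fixes the entries below the middle, sends the middle to the top and lowers the rest
    by one, so every inversion starts at the middle. *)
Lemma coxlen_stair_perm1_longest : coxlen (stair_perm a [:: a] * longest a) <= h.
Proof.
have Ea : a = h.*2.+1 by rewrite -{1}(odd_double_half a) a_odd.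
set u := _ * _; have uE (x : 'I_a) :
    u x = (if x < h then x : nat else if x == h :> nat then a.-1 else x.-1) :> nat.
  case: (stair_entryP x) => p ->; case: (next_index p) => q Eq.
  rewrite permM permE (stair_perm1_entry Eq) /= !val_stair_entry Eq.
  clear u; have := ltn_ord p; case: (boolP (odd p)) => po; case: eqP => /= E;
    by rewrite ?po ?(negPf po) /=; do ?case: ifP; lia.
have lth : h < a by lia.
have ltk (k : 'I_h) : h.+1 + k < a by have := ltn_ord k; lia.
rewrite -[X in _ <= X]card_ord.
pose f k := (Ordinal lth, Ordinal (ltk k)).
apply: leq_trans (subset_leq_card _) (leq_imset_card f _).
apply/subsetP => -[p q]; rewrite inE /= !uE => /andP[pq d].
have Ep : p = h :> nat by move: d; do ?case: ifP; lia.
have ltq : q - h.+1 < h by have := ltn_ord q; lia.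
apply/imsetP; exists (Ordinal ltq) => //; congr (_, _); apply: ord_inj => //=; lia.
Qed.

End OddCycle.

(** * Climbing to a stair form *)

Section Ascent.
Variable n : nat.
Implicit Types (w g : 'S_n) (x y z : 'I_n).

(** Conjugation by (y, y+1) raises the value at [x] by one. It does not move [x], and the preimage
    of y+1 lies above [x], so y is an ascent of the inverse and the length does not drop. *)
Lemma ascend_raise w x y z : w x = y -> y <= z -> (x < y) || (z < x) ->
  (forall v : 'I_n, y < v <= z -> x < w^-1 v) ->
  exists g, [/\ forall v : 'I_n, ~~ (y <= v <= z) -> g v = v, g y = z
              & cox_arrow (w ^ g) w].
Proof.
move Ed: (z - y) => d; elim: d w y Ed => [|d IHd] w y Ed wx yz xout xlt.
  have -> : z = y by apply: ord_inj; lia.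
  by exists 1; split=> [v _||]; rewrite ?perm1 ?conjg1 //; exact: connect0.
have lty' : y.+1 < n by have := ltn_ord z; lia.
pose y' := Ordinal lty'; pose t := tperm y y'.
have tout (v : 'I_n) : ~~ (y <= v <= y.+1) -> t v = v.
  by move=> vout; apply: ord_inj; rewrite val_tperm /=; do ?case: ifP; lia.
have [|||||g [gout gy' ga]] := IHd (w ^ t) y'.
- by rewrite /=; lia.
- have tx : t x = x by apply: tout; lia.
  by rewrite -{1}tx permJ wx tpermL.
- by rewrite /=; lia.
- by rewrite /=; lia.
- move=> v /= v_in.
  have Ev : (w ^ t)^-1 v = t (w^-1 v).
    have tv : t v = v by apply: tout; lia.
    by rewrite -conjVg -{1}tv permJ.
  have xv : x < w^-1 v by apply: xlt; lia.
  rewrite Ev val_tperm /=; case: ifP => [/eqP E|_]; first by move: xv; rewrite E /=; lia.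
  case: ifP => [/eqP E|//]; move: xv; rewrite E; lia.
exists (t * g); split.
- move=> v vout; rewrite permM tout; last by lia.
  by apply: gout; rewrite /=; lia.
- by rewrite permM tpermL.
- rewrite conjgM; apply: connect_trans ga (connect1 _).
  apply/cox_stepP; exists y, y'; split=> //.
    by rewrite conj_tperm -conjgM tperm2 conjg1.
  have wy : w^-1 y = x by rewrite -wx permK.
  by rewrite -conj_tperm coxlen_conj_ascV // wy; apply: xlt => /=; lia.
Qed.

(** The mirror image of [ascend_raise] under w_0. *)
Lemma ascend_lower w x y z : w x = y -> z <= y -> (y < x) || (x < z) ->
  (forall v : 'I_n, z <= v < y -> w^-1 v < x) ->
  exists g, [/\ forall v : 'I_n, ~~ (z <= v <= y) -> g v = v, g y = z
              & cox_arrow (w ^ g) w].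
Proof.
move=> wx zy xout xlt; pose L := longest n.
have [||||g [gout gy ga]] :=
  @ascend_raise (w ^ L) (rev_ord x) (rev_ord y) (rev_ord z).
- by rewrite longestJ rev_ordK wx.
- by rewrite /=; have := ltn_ord y; lia.
- by rewrite !rev_ord_lt.
- move=> v v_in; rewrite -conjVg longestJ rev_ord_lt; apply: xlt.
  by move: v_in; rewrite /=; have := ltn_ord v; have := ltn_ord y; have := ltn_ord z; lia.
exists (g ^ L); split.
- move=> v vout; rewrite longestJ gout ?rev_ordK //.
  by move: vout; rewrite /=; have := ltn_ord v; have := ltn_ord y; have := ltn_ord z; lia.
- by rewrite longestJ gy rev_ordK.
- by have := cox_arrow_longestJ ga; rewrite conjJg !longestK.
Qed.

(** Progress of the climb: the first [k] steps of the stair cycle are in place. *)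
Definition follows_stair w (k : nat) :=
  forall p q : 'I_n, q = p.+1 :> nat -> q <= k -> w (stair_entry p) = stair_entry q.

Lemma iter_follows_stair w k (o p : 'I_n) : o = 0 :> nat -> follows_stair w k -> p <= k ->
  iter p w (stair_entry o) = stair_entry p.
Proof.
move=> o0 fw; case: p => p; elim: p => [|p IHp] lt /= pk.
  by congr stair_entry; apply: ord_inj.
by rewrite (IHp (ltnW lt)) /= ?(fw (Ordinal (ltnW lt)) (Ordinal lt)) //=; lia.
Qed.

Lemma iter_porbit_neq w x k : 0 < k < #|porbit w x| -> iter k w x != x.
Proof.
move=> k_in; have := uniq_traject_porbit w x.
case E: #|porbit w x| k_in => [|c] //=; first by lia.
move=> k_in /andP[nx _]; apply: contra nx => /eqP Ek.
apply/trajectP; exists k.-1; first by lia.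
by rewrite -iterSr prednK ?Ek //; lia.
Qed.

(** The entries at positions beyond k fill an interval. The entry at k lies just outside one end and
    the entry at k + 1 is the opposite end, so the image of the former can be pushed through the
    interval to that end without disturbing the entries already placed. *)
Lemma ascend_stair_step w k (o : 'I_n) : o = 0 :> nat ->
  follows_stair w k -> k.+1 < #|porbit w (stair_entry o)| ->
  exists g, [/\ follows_stair (w ^ g) k.+1, g (stair_entry o) = stair_entry o
              & cox_arrow (w ^ g) w].
Proof.
move=> o0 fw lta.
have lta' := leq_trans lta (max_card _); rewrite card_ord in lta'.
pose P := Ordinal (ltnW lta'); pose Q := Ordinal lta'.
have [r Er] := stair_entryP (w (stair_entry P)).
have w_beyond (p q : 'I_n) : w (stair_entry p) = stair_entry q -> k < q -> k <= p.
  move=> wp kq; rewrite leqNgt; apply/negP => pk.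
  have [s Es] := next_index p; rewrite (_ : _ == n = false) in Es; last by lia.
  move: wp; rewrite (fw p s) ?Es // => /stair_entry_inj Esq.
  by move: kq; rewrite -Esq Es; lia.
(* An image at position at most k would close the cycle too early or be hit twice. *)
have rk : k < r.
  rewrite ltnNge; apply/negP => rk.
  have [r0|r_gt0] := posnP r.
    have := @iter_porbit_neq w (stair_entry o) k.+1; rewrite lta => /(_ isT).
    rewrite iterS (@iter_follows_stair w k o P) // Er.
    by rewrite (_ : r = o) ?eqxx //; apply: ord_inj; rewrite r0.
  have lt : r.-1 < n by have := ltn_ord r; lia.
  have := fw (Ordinal lt) r; rewrite /= prednK // => /(_ erefl rk).
  by rewrite -Er => /perm_inj/stair_entry_inj/(congr1 (@nat_of_ord n)) /=; lia.
have [g [gout gy ga]] : exists g,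
    [/\ forall s : 'I_n, s <= k -> g (stair_entry s) = stair_entry s,
    g (stair_entry r) = stair_entry Q & cox_arrow (w ^ g) w].
  have ltP := ltn_ord P; have ltr := ltn_ord r.
  have [k_odd|k_even] := boolP (odd k).
    have [|||g [gout gy ga]] := @ascend_lower w _ _ (stair_entry Q) Er.
    - rewrite !val_stair_entry /= k_odd /=; case: ifP; lia.
    - rewrite !val_stair_entry /= k_odd /=; case: ifP; lia.
    - move=> v v_in; have [s Es] := stair_entryP v; have [c Ec] := stair_entryP (w^-1 v).
      have ltc := ltn_ord c; have lts := ltn_ord s.
      have wc : w (stair_entry c) = stair_entry s by rewrite -Ec permKV.
      have ks : k < s.
        by move: v_in; rewrite Es !val_stair_entry /= k_odd /=; do 2 case: ifP; lia.
      have kc := w_beyond _ _ wc ks.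
      have ck : c != k :> nat.
        apply/eqP => ck; have E : c = P by apply: ord_inj.
        by move: v_in; rewrite Es -wc E Er ltnn ?andbF.
      by rewrite Ec !val_stair_entry /= k_odd /=; case: ifP; lia.
    exists g; split=> // s sk; apply: gout.
    by rewrite !val_stair_entry /= k_odd /=; do 2 case: ifP; lia.
  have [|||g [gout gy ga]] := @ascend_raise w _ _ (stair_entry Q) Er.
  - rewrite !val_stair_entry /= (negPf k_even) /=; case: ifP; lia.
  - rewrite !val_stair_entry /= (negPf k_even) /=; case: ifP; lia.
  - move=> v v_in; have [s Es] := stair_entryP v; have [c Ec] := stair_entryP (w^-1 v).
    have ltc := ltn_ord c; have lts := ltn_ord s.
    have wc : w (stair_entry c) = stair_entry s by rewrite -Ec permKV.
    have ks : k < s.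
      by move: v_in; rewrite Es !val_stair_entry /= (negPf k_even) /=; do 2 case: ifP; lia.
    have kc := w_beyond _ _ wc ks.
    have ck : c != k :> nat.
      apply/eqP => ck; have E : c = P by apply: ord_inj.
      by move: v_in; rewrite Es -wc E Er ltnn ?andbF.
    by rewrite Ec !val_stair_entry /= (negPf k_even) /=; case: ifP; lia.
  exists g; split=> // s sk; apply: gout.
  by rewrite !val_stair_entry /= (negPf k_even) /=; do 2 case: ifP; lia.
exists g; split=> //; last by rewrite gout // o0.
move=> p q qp; rewrite leq_eqVlt => /orP[/eqP qk|qk].
  have -> : p = P by apply: ord_inj; move: qp; rewrite qk => -[].
  have -> : q = Q by apply: ord_inj.
  by rewrite -{1}(gout P) // permJ Er gy.
by rewrite -{1}(gout p) ?permJ ?(fw p q) ?gout //; lia.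
Qed.

End Ascent.

(** By finiteness [w] permutes the outer labels, hence the inner ones too. *)
Lemma odot_split a m (w : 'S_(a + m)) :
  (forall i, exists i', w (outer_label m i) = outer_label m i') ->
  exists s t, w = odot s t.
Proof.
case/fin_all_exists=> f wf.
have f_inj : injective f.
  move=> i i' E; have := wf i; rewrite E -wf => /perm_inj; exact: outer_label_inj.
have /fin_all_exists[g wi] j : exists j', w (inner_label a j) = inner_label a j'.
  case E: _ / (labelP (w (inner_label a j))) => [i'|j']; last by exists j'.
  have [f' _ fK] := injF_bij f_inj; move: E; rewrite -(fK i') -wf => /perm_inj E.
  by have := outer_neq_inner (f' i') j; rewrite -E eqxx.
have g_inj : injective g.
  move=> i i' E; have := wi i; rewrite E -wi => /perm_inj; exact: inner_label_inj.
by exists (perm f_inj), (perm g_inj); apply: perm_odot_ext => x; rewrite permE.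
Qed.

Lemma turnK a m (t : 'S_m) : (t ^ turn a m) ^ turn a m = t.
Proof. by rewrite /turn; case: (odd a) => /=; [exact: longestK | rewrite !conjg1]. Qed.

Lemma cox_arrow_turn a m (t t' : 'S_m) :
  cox_arrow t t' -> cox_arrow (t ^ turn a m) (t' ^ turn a m).
Proof. by rewrite /turn; case: (odd a); rewrite ?conjg1 //=; exact: cox_arrow_longestJ. Qed.

Lemma coxlen_turn a m (t : 'S_m) : coxlen (t ^ turn a m) = coxlen t.
Proof. by rewrite /turn; case: (odd a); rewrite ?conjg1 ?coxlen_longestJ. Qed.

Lemma ascend_follows_stair n (w : 'S_n) (o : 'I_n) k : o = 0 :> nat ->
  k < #|porbit w (stair_entry o)| ->
  exists w', [/\ follows_stair w' k, cox_arrow w' w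
    & #|porbit w' (stair_entry o)| = #|porbit w (stair_entry o)|].
Proof.
move=> o0; elim: k => [|k IHk] lt.
  exists w; split=> //; last exact: connect0.
  by move=> p q ->.
have [w' [fw aw cw]] := IHk (ltnW lt).
have [|g [fg go ga]] := ascend_stair_step o0 fw; first by rewrite cw.
exists (w' ^ g); split=> //; first exact: connect_trans ga aw.
rewrite -cw -{1}go (_ : porbit _ _ = g @: porbit w' (stair_entry o)).
  by rewrite card_imset //; exact: perm_inj.
by apply: porbit_morph => y; rewrite permJ.
Qed.

Lemma ascend_first_cycle n (w : 'S_n) (o : 'I_n) : o = 0 :> nat ->
  let a := #|porbit w (stair_entry o)| in
  exists w', cox_arrow w' w /\
    forall p q : 'I_n, p < a -> q = (if p.+1 == a then 0 else p.+1) :> nat ->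
      w' (stair_entry p) = stair_entry q.
Proof.
move=> o0 a; have a_gt0 : 0 < a by rewrite lt0n card_porbit_neq0.
have [|w' [fw aw cw]] := @ascend_follows_stair n w o a.-1 o0.
  by rewrite prednK // leqnn.
exists w'; split=> // p q pa; case: eqP => [pa1|pa1] qE; last by rewrite (fw p q) //; lia.
have -> : q = o by apply: ord_inj; rewrite qE.
(* The image of the last entry is the a-th iterate of the first one, hence the first one again. *)
rewrite -(@iter_follows_stair n w' a.-1 o p) //; last by lia.
by rewrite -iterS pa1 /a -cw iter_porbit.
Qed.

(** Once the cycle of the first entry follows the stair it fills the first a positions. The
    permutation is then a product with the stair cycle, and the climb continues in the inner
    factor. *)
Lemma ascend_to_stair n (w : 'S_n) :
  exists gamma, [/\ all (leq 1) gamma, sumn gamma = n & cox_arrow (stair_perm n gamma) w].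
Proof.
elim/ltn_ind: n w => n IHn w; have [n0|n_gt0] := posnP n.
  exists [::]; split=> //; rewrite (_ : stair_perm n [::] = w); first exact: connect0.
  by apply/permP=> x; exfalso; have := ltn_ord x; lia.
pose o := Ordinal n_gt0; have [w' [aw wE]] := @ascend_first_cycle n w o erefl.
have := card_porbit_neq0 w (stair_entry o); rewrite -lt0n.
have := max_card (mem (porbit w (stair_entry o))); rewrite card_ord.
move: wE; set a := #|_| => wE a_le a_gt0.
have [m Em] : exists m, n = a + m by exists (n - a); rewrite subnKC.
move: a a_gt0 {a_le} Em wE; clear o => a a_gt0 Em wE; subst n.
have [s [t Et]] : exists s t, w' = odot s t.
  apply: odot_split => i; have [p ->] := stair_entryP i; have [q qE] := next_index p.
  by exists (stair_entry q); rewrite -!stair_entry_outer;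
    exact: (wE (lshift m p) (lshift m q) (ltn_ord p) qE).
have Es : s = stair_perm a [:: a].
  apply/permP => x; have [p ->] := stair_entryP x; have [q qE] := next_index p.
  rewrite (stair_perm1_entry qE); apply: (@outer_label_inj a m).
  by rewrite -(odot_outer s t) -Et -!stair_entry_outer;
    exact: (wE (lshift m p) (lshift m q) (ltn_ord p) qE).
(* The inner factor is turned before its climb and turned back afterwards, to match
   [stair_perm_cons]. *)
have [|gamma [g1 gs ga]] := IHn m _ (t ^ turn a m); first by lia.
exists (a :: gamma); split; rewrite /= ?a_gt0 ?gs //.
apply: connect_trans aw; rewrite stair_perm_cons Et Es; apply: cox_arrow_inner.
by have := cox_arrow_turn a ga; rewrite turnK.
Qed.

Lemma porbits_stair_perm1 a : 0 < a -> porbits (stair_perm a [:: a]) = [set setT].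
Proof.
move=> a_gt0; set w := stair_perm _ _; pose o := Ordinal a_gt0.
have full : porbit w (stair_entry o) = setT.
  apply/setP=> x; rewrite inE; have [[p lt] ->] := stair_entryP x.
  elim: p lt => [|p IHp] lt.
    by rewrite (_ : Ordinal lt = o) ?porbit_id //; apply: ord_inj.
  have /= <- := @stair_perm1_entry a (Ordinal (ltnW lt)) (Ordinal lt).
    by rewrite -/w -(expg1 w) -eq_porbit_mem porbit_perm eq_porbit_mem IHp.
  by case: eqP => // E; move: lt; rewrite E ltnn.
apply/setP=> X; rewrite inE; apply/imsetP/eqP => [[x _ ->]|->]; last by exists (stair_entry o).
by rewrite -full; apply/eqP; rewrite eq_porbit_mem full inE.
Qed.

Lemma cycle_type_stair_perm1 a : 0 < a -> cycle_type (stair_perm a [:: a]) = [:: a].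
Proof.
move=> a_gt0; rewrite /cycle_type porbits_stair_perm1 // /block_sizes enum_set1 /=.
by rewrite cardsT card_ord.
Qed.

Lemma cycle_type_stair_perm gamma : all (leq 1) gamma ->
  perm_eq (cycle_type (stair_perm (sumn gamma) gamma)) gamma.
Proof.
elim: gamma => [|a gamma IH] /=.
  move=> _; suff -> : cycle_type (stair_perm 0 [::]) = [::] by [].
  rewrite /cycle_type (_ : porbits _ = set0) /block_sizes ?enum_set0 //.
  by apply/setP=> X; rewrite inE; apply/imsetP => -[[]].
case/andP=> a_gt0 /IH g; rewrite stair_perm_cons.
apply: perm_trans (cycle_type_odot _ _) _.
rewrite cycle_type_stair_perm1 // perm_cons.
exact: perm_trans (cycle_typeJ _ _) g.
Qed.

Section OddBlocks.
Variable a : nat.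
Hypothesis a_odd : odd a.

(** The lower half has one entry more than the upper half, so it cannot be sent into it entirely. *)
Lemma crossings_le (s : 'S_a) : crossings s <= a.-1.
Proof.
have Ea := odd_double_half a; rewrite a_odd in Ea.
have a_gt0 : 0 < a by lia.
rewrite -ltnS prednK // -[X in _ < X](card_ord a) -cardsT.
apply: proper_card; rewrite properEneq subsetT andbT.
apply/eqP => full.
have ltk (k : 'I_(uphalf a)) : k < a by have := ltn_ord k; lia.
have gP (k : 'I_(uphalf a)) : s (Ordinal (ltk k)) - uphalf a < a./2.
  have : Ordinal (ltk k) \in [set: 'I_a] by rewrite inE.
  by rewrite -full inE /= ltn_ord /=; have := ltn_ord (s (Ordinal (ltk k))); lia.
pose g k := Ordinal (gP k).
have g_inj : injective g.
  move=> k k' [E].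
  have : Ordinal (ltk k) \in [set: 'I_a] by rewrite inE.
  have : Ordinal (ltk k') \in [set: 'I_a] by rewrite inE.
  rewrite -full !inE /= !ltn_ord /= -!leqNgt => le le'.
  have Es : s (Ordinal (ltk k)) = s (Ordinal (ltk k')) :> nat by lia.
  by case: (perm_inj (ord_inj Es)) => /ord_inj.
have := leq_card _ g_inj; rewrite !card_ord; lia.
Qed.

(** Multiplication by w_0 complements the length, so the bound for the stair cycle carries over to
    [s] and [crossings_ge] applies. *)
Lemma crossings_max (s : 'S_a) : porbits s = [set setT] ->
  coxlen s = coxlen (stair_perm a [:: a]) -> crossings s = a.-1.
Proof.
move=> sT len; apply/eqP; rewrite eqn_leq crossings_le crossings_ge //.
apply: leq_trans (coxlen_stair_perm1_longest a_odd).
by rewrite -(leq_add2l (coxlen s)) {2}len !coxlen_mul_longest.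
Qed.

End OddBlocks.

(** * Permutations of maximal length in their conjugacy class *)

Definition stair_len gamma := coxlen (stair_perm (sumn gamma) gamma).

Lemma stair_len_cons a gamma : odd a ->
  stair_len (a :: gamma) = stair_len [:: a] + stair_len gamma + (sumn gamma * a.-1)%N.
Proof.
move=> a_odd; have E : stair_len [:: a] = coxlen (stair_perm a [:: a]).
  by rewrite /stair_len /= addn0.
rewrite E /stair_len stair_perm_cons coxlen_odot coxlen_turn crossings_max //.
exact: porbits_stair_perm1 (odd_gt0 a_odd).
Qed.

(** Moving a past an adjacent smaller part b gains b(a-1) - a(b-1) = a - b. The boolean summand
    records strictness. *)
Lemma stair_len_move_front a gamma delta : odd a -> all odd gamma -> all (gtn a) gamma ->
  stair_len (gamma ++ a :: delta) + (gamma != [::]) <= stair_len (a :: gamma ++ delta).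
Proof.
move=> a_odd; elim: gamma => [|b gamma IH] /=; first by rewrite addn0.
case/andP=> b_odd g_odd /andP[ba ga]; have := IH g_odd ga.
rewrite (stair_len_cons (gamma ++ _) a_odd) (stair_len_cons (b :: _) a_odd).
rewrite !(stair_len_cons (gamma ++ _) b_odd) /= !sumn_cat /=.
clear IH; case: a a_odd ba {ga} => [|a] //= _ ba; case: b b_odd ba => [|b] //= _ ba.
lia.
Qed.

(** Cutting [gamma] at the first occurrence of the largest part leaves only smaller parts before it,
    so moving it to the front is a strict gain unless it is there already; induction treats the
    rest. *)
Lemma stair_len_sorted alpha gamma : all odd alpha -> sorted geq alpha ->
  perm_eq gamma alpha ->
  stair_len gamma <= stair_len alpha /\
  (stair_len alpha <= stair_len gamma -> gamma = alpha).
Proof.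
elim: alpha gamma => [|a alpha IH] gamma.
  by move=> _ _ /perm_nilP ->.
move=> /= /andP[a_odd al_odd] al_s pe.
have ag : a \in gamma by rewrite (perm_mem pe) mem_head.
have := pe; move: (cat_take_drop (index a gamma) gamma).
rewrite (drop_nth a) ?index_mem // nth_index //.
set g1 := take _ _; set g2 := drop _ _ => Eg.
have ng1 : a \notin g1 by rewrite in_take // ltnn.
rewrite -Eg => pe'.
have pe2 : perm_eq (g1 ++ g2) alpha.
  by rewrite -(perm_cons a) (perm_trans _ pe') // perm_sym perm_catC /= perm_cons perm_catC.
have [l1 l2] := IH _ al_odd (path_sorted al_s) pe2.
have geq_trans : transitive geq by move=> x y z /= yx zy; exact: leq_trans zy yx.
have g1a : all (gtn a) g1.
  apply/allP=> b bg; have := order_path_min geq_trans al_s; rewrite -(perm_all _ pe2).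
  move=> /allP/(_ b); rewrite mem_cat bg => /(_ isT) /= ba.
  by rewrite ltn_neqAle ba andbT; apply: contra ng1 => /eqP <-.
have g1_odd : all odd g1.
  by move: al_odd; rewrite -(perm_all _ pe2) all_cat => /andP[].
have := stair_len_move_front g2 a_odd g1_odd g1a.
rewrite (stair_len_cons (g1 ++ _) a_odd) (stair_len_cons alpha a_odd) (perm_sumn pe2).
set K := muln _ _; move: K => K.
clear -l1 l2.
case: (altP (g1 =P [::])) l1 l2 => [->|_] /= l1 l2 mv; split; try lia.
  by move=> le; congr (_ :: _); apply: l2; lia.
Qed.

(** [w] climbs to a stair form of its cycle type, at most as long as the sorted one. If [w] is
    itself that long, the form reached is the sorted one and the climb kept the length, which gives
    equivalence. *)
Lemma max_length_in_Sigma alpha n (w : 'S_n) : sumn alpha = n ->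
  all odd alpha -> sorted geq alpha -> perm_eq (cycle_type w) alpha ->
  coxlen w <= stair_len alpha /\ (stair_len alpha <= coxlen w -> w \in Sigma n alpha).
Proof.
move=> En al_odd al_s ct; have [gamma [g1 gs ga]] := ascend_to_stair w.
have gct : perm_eq gamma alpha.
  have [g Eg] := cox_arrow_conj ga; rewrite perm_sym in ct.
  have := cycle_type_stair_perm g1; rewrite gs perm_sym => /perm_trans; apply.
  rewrite perm_sym; apply: perm_trans ct _.
  by rewrite Eg; exact: cycle_typeJ.
have [le eq] := stair_len_sorted al_odd al_s gct.
have lw := cox_arrow_len ga.
have Eg : stair_len gamma = coxlen (stair_perm n gamma) by rewrite /stair_len gs.
split; first by rewrite (leq_trans lw) // -Eg.
move=> le'; have E : gamma = alpha by apply: eq; rewrite (leq_trans le') // Eg.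
rewrite inE -E; apply: cox_arrow_approx => //.
by rewrite (leq_trans _ le') // -E Eg.
Qed.

(** * Odd first part *)

Lemma porbits_eq_porbit (T : finType) (s t : {perm T}) x :
  porbits s = porbits t -> porbit s x = porbit t x.
Proof.
move=> E; have : porbit s x \in porbits t by rewrite -E imset_f.
case/imsetP=> y _ Exy; rewrite Exy; apply/eqP.
by rewrite eq_sym eq_porbit_mem -Exy porbit_id.
Qed.

Lemma porbits_odot_split a m (w : 'S_(a + m)) s t :
  porbits w = porbits (odot s t) -> exists s' t', w = odot s' t'.
Proof.
move=> E; apply: odot_split => i.
have : w (outer_label m i) \in porbit w (outer_label m i).
  by rewrite -{1}(expg1 w) mem_porbit.
by rewrite (porbits_eq_porbit _ E) porbit_outer => /imsetP[i' _ ->]; exists i'.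
Qed.

Lemma porbits_odot_inj a m (s s' : 'S_a) (t t' : 'S_m) :
  porbits (odot s t) = porbits (odot s' t') ->
  porbits s = porbits s' /\ porbits t = porbits t'.
Proof.
move=> E; split.
  have Es i : porbit s i = porbit s' i.
    apply: (imset_inj (@outer_label_inj a m)).
    by rewrite -(porbit_outer s t) (porbits_eq_porbit _ E) porbit_outer.
  by apply: eq_imset.
have Et j : porbit t j = porbit t' j.
  apply: (imset_inj (@inner_label_inj a m)).
  by rewrite -(porbit_inner s t) (porbits_eq_porbit _ E) porbit_inner.
by apply: eq_imset.
Qed.

Lemma Sigma_len n alpha (w : 'S_n) : sumn alpha = n ->
  w \in Sigma n alpha -> coxlen w = stair_len alpha.
Proof. by move=> En; rewrite inE /stair_len En => /cox_approx_len. Qed.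

Lemma Sigma_timesE n alpha (w : 'S_n) :
  (w \in Sigma_times n alpha)
  = (w \in Sigma n alpha) && (porbits w == porbits (stair_perm n alpha)).
Proof. by rewrite in_set. Qed.

(** With the orbits prescribed, membership in the class amounts to maximal length, and each summand
    of [coxlen_odot] is bounded by its value for the stair forms. *)
Lemma Sigma_times_odot a beta (s : 'S_a) (t : 'S_(sumn beta)) :
  odd a -> all odd beta -> sorted geq (a :: beta) ->
  (odot s t \in Sigma_times (a + sumn beta) (a :: beta)) =
  (s \in Sigma_times a [:: a]) && (t ^ longest _ \in Sigma_times (sumn beta) beta).
Proof.
move=> a_odd b_odd ab_sorted; set m := sumn beta in t *.
have a_gt0 := odd_gt0 a_odd.
have E : stair_perm (a + m) (a :: beta)
    = odot (stair_perm a [:: a]) (stair_perm m beta ^ longest m).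
  by rewrite stair_perm_cons /turn a_odd.
have b_pos : all (leq 1) beta by apply: sub_all b_odd => b; exact: odd_gt0.
have La : stair_len [:: a] = coxlen (stair_perm a [:: a]) by rewrite /stair_len /= addn0.
have Ea : sumn [:: a] = a by rewrite /= addn0.
have sT : porbits s = porbits (stair_perm a [:: a]) ->
    porbits s = [set setT] /\ perm_eq (cycle_type s) [:: a].
  move=> ps; split; first by rewrite ps porbits_stair_perm1.
  by have := cycle_type_stair_perm1 a_gt0; rewrite /cycle_type ps => ->.
have tT : porbits (t ^ longest m) = porbits (stair_perm m beta) ->
    perm_eq (cycle_type (t ^ longest m)) beta.
  by move=> pt; rewrite /cycle_type pt; exact: cycle_type_stair_perm.
have s_max ps := @max_length_in_Sigma [:: a] a s Ea (introT andP (conj a_odd isT)) isT (sT ps).2.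
have t_max pt := max_length_in_Sigma (erefl m) b_odd (path_sorted ab_sorted) (tT pt).
rewrite coxlen_longestJ in t_max.
have len := stair_len_cons beta a_odd; rewrite -/m in len.
rewrite !Sigma_timesE.
apply/andP/andP => [[wS /eqP pw]|[/andP[sS /eqP ps] /andP[tS /eqP pt]]].
  have [ps pt'] : porbits s = porbits (stair_perm a [:: a])
      /\ porbits t = porbits (stair_perm m beta ^ longest m).
    by apply: porbits_odot_inj; rewrite pw E.
  have pt : porbits (t ^ longest m) = porbits (stair_perm m beta).
    by rewrite porbitsJ pt' -porbitsJ longestK.
  have := @Sigma_len (a + m) (a :: beta) _ (erefl _) wS; rewrite coxlen_odot len.
  have [ls sS] := s_max ps; have [lt tS] := t_max pt.
  have lc := leq_mul (leqnn m) (crossings_le a_odd s) => lw.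
  (* The total equals the sum of the three upper bounds, so each bound is attained. *)
  have [ls' lt'] : stair_len [:: a] <= coxlen s /\ stair_len beta <= coxlen t.
    set K := muln _ _ in lw lc; set K' := muln _ _ in lw lc; move: K K' lw lc => K K' lw lc.
    by clear -lw lc ls lt; lia.
  by rewrite ps pt sS // tS // !eqxx.
have pw : porbits (odot s t) = porbits (stair_perm (a + m) (a :: beta)).
  rewrite E !porbits_odot ps; congr (_ :|: [set _ | X in _]).
  by rewrite porbitsJ -pt -porbitsJ longestK.
rewrite pw eqxx; split=> //.
have ls := Sigma_len Ea sS; have lt := @Sigma_len m beta _ (erefl _) tS.
rewrite coxlen_longestJ in lt.
have ct : perm_eq (cycle_type (odot s t)) (a :: beta).
  rewrite (perm_trans (cycle_type_odot _ _)) // (perm_cat (sT ps).2) //.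
  by rewrite -(permPl (cycle_typeJ _ (longest m))) tT.
have ab_odd : all odd (a :: beta) by rewrite /= a_odd.
have [_ ->] // := @max_length_in_Sigma (a :: beta) (a + m) _ (erefl _) ab_odd ab_sorted ct.
by rewrite len coxlen_odot ls lt crossings_max ?(sT ps).1 // -La.
Qed.

Theorem corollary4p56 (alpha1 : nat) (beta : seq nat)
    (max_alpha : maximal_composition (alpha1 + sumn beta) (alpha1 :: beta)) :
  (~~ odd alpha1 ->
     bij_onto (fun s : 'S_alpha1 * 'S_(sumn beta) => odot s.1 s.2)
       (setX (Sigma alpha1 [:: alpha1]) (Sigma (sumn beta) beta))
       (Sigma (alpha1 + sumn beta) (alpha1 :: beta)))
  /\
  (odd alpha1 ->
     bij_onto (fun s : 'S_alpha1 * 'S_(sumn beta) => odot s.1 s.2)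
       (setX (Sigma_times alpha1 [:: alpha1])
             (Sigma_times (sumn beta) beta :^ longest (sumn beta))%g)
       (Sigma_times (alpha1 + sumn beta) (alpha1 :: beta))).
Proof.
split; first exact: odot_bij_even.
(* An odd first part forces k = 0 in the definition of maximality. *)
move=> a_odd; have [b_odd ab_sorted] : all odd beta /\ sorted geq (alpha1 :: beta).
  case: max_alpha => _ [[|k]] [_ /= ev od so]; last by rewrite a_odd in ev.
  by case/andP: od.
have mem_conj (t : 'S_(sumn beta)) :
    (t \in Sigma_times (sumn beta) beta :^ longest _)
    = (t ^ longest _ \in Sigma_times (sumn beta) beta).
  by rewrite mem_conjg longestV.
split; first by move=> [s t] [s' t'] _ _ /= /odot_inj[-> ->].
apply/setP=> w; apply/imsetP/idP => [[[s t]]|wS].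
  by rewrite inE mem_conj => stS -> /=; rewrite Sigma_times_odot.
(* [w] has the orbits of an inductive product, hence stabilises the outer labels. *)
have [s [t Ew]] : exists s t, w = odot s t.
  move: wS; rewrite inE => /andP[_ /eqP]; rewrite stair_perm_cons.
  exact: porbits_odot_split.
exists (s, t) => //; rewrite inE mem_conj /= -Sigma_times_odot // -Ew //.
Qed.
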